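(* For a function $f \colon \mathbb{R}^n \to \mathbb{R}$, with $n \geq 3$, the following conditions are equivalent: (a) $f$ is regular on $\mathbb{R}^n$. (b) The restriction of $f$ to every Euclidean $2$-sphere in $\mathbb{R}^n$ is a regular function.
   Context: Regular functions: for $A\subset\mathbb{R}^n$, a function $f\colon A\to\mathbb{R}$ is regular at $a\in A$ if there are polynomial functions $\varphi,\psi\colon\mathbb{R}^n\to\mathbb{R}$ with $\psi(a)\neq 0$ and $f(x)=\varphi(x)/\psi(x)$ for all $x\in A$ with $\psi(x)\neq0$; $f$ is regular on $A$ if it is regular at every point of $A$. A Euclidean $2$-sphere in $\mathbb{R}^n$ is a set of the form $\{x\in\mathbb{R}^n:\|x-x_0\|=r\}\cap Q$, where $Q$ is an affine $3$-plane in $\mathbb{R}^n$, $x_0\in Q$ and $r>0$. *)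

(* Defs.v *)
From mathcomp Require Import all_boot all_order all_algebra.
From mathcomp Require Import classical_sets reals.
From mathcomp Require mpoly.

Set Implicit Arguments.
Unset Strict Implicit.
Unset Printing Implicit Defensive.

Import Order.TTheory GRing.Theory Num.Theory.

Local Open Scope classical_set_scope.
Local Open Scope ring_scope.

(* Only the values of [f] on [A] matter, so for [f] defined on all of R^n,
   [regular_on A f] is regularity of the restriction of [f] to [A]. *)
Definition regular_at (R : realType) (n : nat) (A : set 'rV[R]_n)
    (f : 'rV[R]_n -> R) (a : 'rV[R]_n) : Prop :=
  exists phi psi : mpoly.mpoly n R,
    mpoly.meval (a ord0) psi != 0 /\
    forall x : 'rV[R]_n, A x -> mpoly.meval (x ord0) psi != 0 ->
      f x = mpoly.meval (x ord0) phi / mpoly.meval (x ord0) psi.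

Definition regular_on (R : realType) (n : nat) (A : set 'rV[R]_n)
    (f : 'rV[R]_n -> R) : Prop :=
  forall a : 'rV[R]_n, A a -> regular_at A f a.

(* The norm that MathComp-Analysis puts on ['rV[R]_n] is the sup norm. *)
Definition enorm (R : realType) (n : nat) (x : 'rV[R]_n) : R :=
  Num.sqrt (\sum_(i < n) x ord0 i ^+ 2).

Definition affine_plane (R : realType) (n d : nat) (Q : set 'rV[R]_n) : Prop :=
  exists (q : 'rV[R]_n) (W : {vspace 'rV[R]_n}),
    \dim W = d /\ Q = [set x | x - q \in W].

Definition euclidean_2sphere (R : realType) (n : nat) (S : set 'rV[R]_n) : Prop :=
  exists (Q : set 'rV[R]_n) (x0 : 'rV[R]_n) (r : R),
    [/\ affine_plane 3 Q, Q x0, 0 < r &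
        S = [set x | enorm (x - x0) = r] `&` Q].

(* Main.v *)
Require Import Defs.
From mathcomp Require Import all_boot all_order all_algebra.
From mathcomp Require Import boolp classical_sets cardinality reals.
From mathcomp Require Import ereal measure lebesgue_measure.
From mathcomp Require Import ring zify.
From mathcomp Require mpoly.
Import (canonicals) mpoly.

(** Only the passage from spheres to the whole space needs an argument.

    Inversion with a center [b] exchanges the 2-spheres through [b] with the
    2-planes avoiding [b].  So fix a point [a], choose [b != a], and replace
    [f] by [G y = f (b + y / |y|^2)]: this [G] is regular on every affine plane
    that avoids the origin, and it suffices to prove it regular at every point
    of R^n other than the origin ([regular_off_origin]).

    On a line avoiding the origin, [G] is a rational function of one variable;
    its degree is the least [d] for which it is a quotient of two polynomials
    of degree at most [d].  A function has degree at most [d] exactly when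
    certain determinants in its values vanish ([det_degle]).  In a family of
    parallel lines, or of lines turning in a plane, those determinants are
    regular functions of the parameter.  So if infinitely many lines of the
    family have degree at most [d], then all of them do ([degle_family]).
    Since the reals are not a countable union of finite sets, this makes the
    degrees along all lines bounded ([bounded_degree]).

    Let [a != 0], and let [D] be the largest degree of [G] along the lines
    through [a] that avoid the origin.  Then [D] bounds the degrees along all
    lines avoiding the origin ([degle_spread]).  Indeed any line is, up to a perturbation, coplanar with [a]; in that plane
    [G] is a fraction [P / Q] in lowest terms, and being regular at [a] it has
    no base point there.  The restriction of [P / Q] to a general line
    through [a] therefore does not simplify, so its degree is the total degree
    of [P / Q], the largest possible ([pencil_degle]).

    Finally take a line through [a] along which the degree is exactly [D].
    All parallel lines have degree at most [D], so that Cramer's rule, applied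
    to the values of [G] on suitable hyperplanes transversal to the line,
    produces a numerator and a denominator for [G] that are valid on all
    parallel lines at once.  On the line through [a] the solution is unique up
    to a scalar, whence the denominator does not vanish at [a].  The
    coefficients are polynomials in the values of [G] on hyperplanes avoiding
    the origin, where [G] is regular by induction on the dimension
    ([regular_transversal]). *)

Set Implicit Arguments.
Unset Strict Implicit.
Unset Printing Implicit Defensive.
Import Order.TTheory GRing.Theory Num.Theory.
Local Open Scope classical_set_scope.
Local Open Scope ring_scope.

(** * Infinite sets of parameters *)

Section Large.
Variable R : realType.

(** Infinitely many reals satisfy [A], in the form in which finitely many bad
    parameters are discarded below. *)
Definition many (A : R -> Prop) := forall s : seq R, exists2 x, x \notin s & A x.

Lemma many_sub (A B : R -> Prop) : (forall x, A x -> B x) -> many A -> many B.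
Proof. by move=> AB mA s; have [x xs /AB Bx] := mA s; exists x. Qed.

Lemma many_notin (s : seq R) (A : R -> Prop) :
  many A -> many (fun x => x \notin s /\ A x).
Proof.
move=> mA s'; have [x] := mA (s ++ s').
by rewrite mem_cat negb_or => /andP[xs xs'] Ax; exists x.
Qed.

Lemma few_seq (A : R -> Prop) : ~ many A -> exists s : seq R, forall x, A x -> x \in s.
Proof.
move=> nA; apply: contrapT => ns; apply: nA => s; apply: contrapT => nx.
apply: ns; exists s => x Ax; apply/negP => xs; apply: nx; exists x => //.
by apply/negP.
Qed.

Lemma reals_not_countable_union (s : nat -> seq R) : exists x, forall n, x \notin s n.
Proof.
apply: contrapT => nx.
have cov : `[0, 1]%classic `<=` \bigcup_n [set` s n].
  move=> x _; apply: contrapT => h; apply: nx; exists x => n; apply/negP => xs.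
  by apply: h; exists n.
have : countable (`[0, 1]%classic : set R).
  apply: sub_countable (bigcup_countable _ _).
  - exact: (subset_card_le cov).
  - exact: countableP.
  - by move=> n _; exact/finite_set_countable/finite_seq.
move/countable_lebesgue_measure0; rewrite lebesgue_measure_itv /= lte_fin ltr01.
by rewrite oppr0 adde0 => /eqP; rewrite eqe oner_eq0.
Qed.

(** The only use of the uncountability of the reals: it turns degrees that are
    finite one by one into degrees bounded along an infinite set. *)
Lemma many_pigeonhole (Q : R -> nat -> Prop) :
  (forall x, exists d, Q x d) -> exists d, many (Q^~ d).
Proof.
move=> ex; apply: contrapT => nd.
have fd d : exists s : seq R, forall x, Q x d -> x \in s.
  by apply: few_seq => m; apply: nd; exists d.
have [s sP] := choice fd.
have [x xs] := reals_not_countable_union s.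
by have [d Qxd] := ex x; have := xs d; rewrite sP.
Qed.
End Large.

(** * Algebras of functions and regularity at a point *)

Section FunctionAlgebras.
Variable R : realType.

(** One notion of regularity serves for lines, planes and R^n: only the algebra
    of polynomial functions changes. *)
Record funalg (X : Type) (A : (X -> R) -> Prop) : Prop := FunAlg {
  funalg_cst : forall c, A (fun=> c);
  funalg_add : forall f g, A f -> A g -> A (fun x => f x + g x);
  funalg_mul : forall f g, A f -> A g -> A (fun x => f x * g x) }.

Lemma funalg_sum X (A : (X -> R) -> Prop) (I : Type) (r : seq I) (F : I -> X -> R) :
  funalg A -> (forall i, A (F i)) -> A (fun x => \sum_(i <- r) F i x).
Proof.
move=> [Ac Aa _] AF; elim: r => [|i r IH].
  by under eq_fun do rewrite big_nil; exact: Ac.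
by under eq_fun do rewrite big_cons; exact: Aa.
Qed.

Lemma funalg_prod X (A : (X -> R) -> Prop) (I : Type) (r : seq I) (F : I -> X -> R) :
  funalg A -> (forall i, A (F i)) -> A (fun x => \prod_(i <- r) F i x).
Proof.
move=> [Ac _ Am] AF; elim: r => [|i r IH].
  by under eq_fun do rewrite big_nil; exact: Ac.
by under eq_fun do rewrite big_cons; exact: Am.
Qed.

Lemma funalg_exp X (A : (X -> R) -> Prop) (f : X -> R) k :
  funalg A -> A f -> A (fun x => f x ^+ k).
Proof.
move=> alA Af; under eq_fun do rewrite -[k in _ ^+ k]card_ord -prodr_const.
exact: funalg_prod.
Qed.

Lemma funalg_det X (A : (X -> R) -> Prop) n (M : X -> 'M[R]_n) :
  funalg A -> (forall i j, A (fun x => M x i j)) -> A (fun x => \det (M x)).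
Proof.
move=> alA AM; apply: funalg_sum => // s.
by apply: funalg_mul; [|exact: funalg_cst|exact: funalg_prod].
Qed.

(** The equation [psi * f = phi] is imposed everywhere, also where [psi]
    vanishes; replacing [phi / psi] by [phi * psi / psi ^ 2] shows that this loses
    no generality, and it makes algebraic manipulations free of side
    conditions. *)
Definition regat X (A : (X -> R) -> Prop) (f : X -> R) (a : X) :=
  exists phi psi, [/\ A phi, A psi, psi a != 0 & forall x, psi x * f x = phi x].

Lemma funalg_regat X (A : (X -> R) -> Prop) a : funalg A -> funalg (regat A ^~ a).
Proof.
move=> alA; split.
- move=> c; exists (fun=> c), (fun=> 1); split; rewrite ?oner_eq0 //;
    do ?exact: funalg_cst.
  by move=> x; rewrite mul1r.
- move=> f g [p [q [Ap Aq q0 E]]] [p' [q' [Ap' Aq' q0' E']]].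
  exists (fun x => q' x * p x + q x * p' x), (fun x => q x * q' x); split.
  + by apply: funalg_add => //; exact: funalg_mul.
  + exact: funalg_mul.
  + by rewrite mulf_neq0.
  + by move=> x; rewrite -E -E'; ring.
- move=> f g [p [q [Ap Aq q0 E]]] [p' [q' [Ap' Aq' q0' E']]].
  exists (fun x => p x * p' x), (fun x => q x * q' x); split.
  + exact: funalg_mul.
  + exact: funalg_mul.
  + by rewrite mulf_neq0.
  + by move=> x; rewrite -E -E'; ring.
Qed.

Lemma regat_id X (A : (X -> R) -> Prop) f a : funalg A -> A f -> regat A f a.
Proof.
move=> alA Af; exists f, (fun=> 1); split; rewrite ?oner_eq0 //.
  exact: funalg_cst.
by move=> x; rewrite mul1r.
Qed.

Lemma regat_comp X Y (A : (X -> R) -> Prop) (B : (Y -> R) -> Prop) (h : Y -> X) f b :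
  (forall g, A g -> B (g \o h)) -> regat A f (h b) -> regat B (f \o h) b.
Proof.
move=> AB [p [q [Ap Aq q0 E]]]; exists (p \o h), (q \o h).
by split => //; [exact: AB | exact: AB | move=> y /=].
Qed.

(** The factor [r] allows the relation to fail on a hypersurface that misses
    [a]. *)
Lemma regat_div X (A : (X -> R) -> Prop) (f p q r : X -> R) a :
  funalg A -> regat A p a -> regat A q a -> A r -> q a != 0 -> r a != 0 ->
  (forall x, r x != 0 -> q x * f x = p x) -> regat A f a.
Proof.
move=> alA [p1 [p2 [Ap1 Ap2 p20 Ep]]] [q1 [q2 [Aq1 Aq2 q20 Eq]]] Ar qa ra E.
exists (fun x => r x * (q2 x * p1 x)), (fun x => r x * (p2 x * q1 x)); split.
- by do 2![apply: funalg_mul => //].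
- by do 2![apply: funalg_mul => //].
- by rewrite -Eq !mulf_neq0.
- move=> x; have [->|rx] := eqVneq (r x) 0; first by rewrite !mul0r.
  by rewrite -Ep -Eq -(E x rx); ring.
Qed.

Definition poly1 (f : R -> R) := exists p : {poly R}, forall x, f x = p.[x].
Definition poly2 (f : R * R -> R) :=
  exists p : {poly {poly R}}, forall x, f x = p.[x.2%:P].[x.1].
Definition polyn n (f : 'rV[R]_n -> R) :=
  exists p : mpoly.mpoly n R, forall x, f x = mpoly.meval (x ord0) p.

Lemma funalg_poly1 : funalg poly1.
Proof.
split; first by move=> c; exists c%:P => x; rewrite hornerC.
- by move=> f g [p E] [q E']; exists (p + q) => x; rewrite hornerD E E'.
- by move=> f g [p E] [q E']; exists (p * q) => x; rewrite hornerM E E'.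
Qed.

Lemma funalg_poly2 : funalg poly2.
Proof.
split; first by move=> c; exists c%:P%:P => x; rewrite !hornerC.
- by move=> f g [p E] [q E']; exists (p + q) => x; rewrite !hornerD E E'.
- by move=> f g [p E] [q E']; exists (p * q) => x; rewrite !hornerM E E'.
Qed.

Lemma funalg_polyn n : funalg (@polyn n).
Proof.
split; first by move=> c; exists (mpoly.mpolyC n c) => x; rewrite mpoly.mevalC.
- by move=> f g [p E] [q E']; exists (p + q) => x; rewrite mpoly.mevalD E E'.
- by move=> f g [p E] [q E']; exists (p * q) => x; rewrite mpoly.mevalM E E'.
Qed.

Lemma polyn_coord n i : @polyn n (fun x => x ord0 i).
Proof. by exists (mpoly.mpolyX R (mpoly.mnm1 i)) => x; rewrite mpoly.mevalXU. Qed.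

(** The target algebra [A] is arbitrary; besides polynomials in one or two
    variables, it is applied to the functions that become polynomial after
    clearing powers of [|y|^2], for the inversion. *)
Lemma polyn_comp n X (A : (X -> R) -> Prop) (h : X -> 'rV[R]_n) f :
  funalg A -> (forall i, A (fun x => h x ord0 i)) -> polyn f -> A (f \o h).
Proof.
move=> alA Ah [p E].
have -> : f \o h = fun x => mpoly.meval (h x ord0) p.
  by apply/funext => x /=; rewrite E.
under eq_fun do rewrite mpoly.mevalE.
apply: funalg_sum => // m; apply: funalg_mul => //; first exact: funalg_cst.
by apply: funalg_prod => // i; exact: funalg_exp.
Qed.

Lemma poly1_id : poly1 id.
Proof. by exists 'X => x; rewrite hornerX. Qed.

Lemma poly2_fst : poly2 fst.
Proof. by exists ('X%:P) => x; rewrite hornerC hornerX. Qed.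

Lemma poly2_snd : poly2 snd.
Proof. by exists 'X => x; rewrite hornerX hornerC. Qed.

Lemma poly2_comp X (A : (X -> R) -> Prop) (h : X -> R * R) f :
  funalg A -> A (fst \o h) -> A (snd \o h) -> poly2 f -> A (f \o h).
Proof.
move=> alA A1 A2 [p E].
have -> : f \o h = fun x => \sum_(i < size p) \sum_(j < size p`_i)
    p`_i`_j * (h x).1 ^+ j * (h x).2 ^+ i.
  apply/funext => x /=; rewrite E (horner_coef p) horner_sum.
  apply: eq_bigr => i _; rewrite hornerM -polyC_exp hornerC horner_coef mulr_suml.
  by [].
apply: funalg_sum => // i; apply: funalg_sum => // j.
by apply: funalg_mul => //; [apply: funalg_mul => //; first exact: funalg_cst|];
  exact: funalg_exp.
Qed.

Lemma poly_many0 (p : {poly R}) : many (fun x => p.[x] = 0) -> p = 0.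
Proof.
move=> mp; apply/eqP/negP => /negP p0.
have [s /= [us ss] ps] : exists2 s : seq R, uniq s /\ size s = size p & all (root p) s.
  elim: (size p) => [|k [s [us ss] ps]]; first by exists [::].
  have [x xs px] := mp s; exists (x :: s); rewrite /= ?xs ?us ?ss //.
  by rewrite ps andbT; apply/rootP.
by have := max_poly_roots p0 ps us; rewrite ss ltnn.
Qed.

Lemma many_true : many (fun _ : R => True).
Proof.
move=> s; exists (1 + \sum_(x <- s) `|x|) => //; apply/negP => h.
have: `|1 + \sum_(x <- s) `|x| : R| <= \sum_(x <- s) `|x|.
  by rewrite [leRHS](big_rem _ h) /= lerDl sumr_ge0.
rewrite ger0_norm; last by rewrite addr_ge0 // sumr_ge0.
by rewrite gerDr ler10.
Qed.

Lemma poly_ext (p q : {poly R}) : many (fun x => p.[x] = q.[x]) -> p = q.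
Proof.
move=> h; apply/eqP; rewrite -subr_eq0; apply/eqP/poly_many0.
by apply: many_sub h => x E; rewrite hornerD hornerN E subrr.
Qed.

Lemma many_root (p : {poly R}) : p != 0 -> many (fun x => p.[x] != 0).
Proof.
move=> p0; apply: contrapT => /few_seq[s sP].
case/negP: p0; apply/eqP/poly_many0.
apply: many_sub (many_notin s many_true) => x [xs _].
by apply/eqP/negP => /negP /sP; apply/negP.
Qed.

(** Near any point the function is a fraction whose numerator has infinitely
    many zeros. *)
Lemma regat1_many0 (g : R -> R) : (forall t, regat poly1 g t) ->
  many (fun t => g t = 0) -> forall t, g t = 0.
Proof.
move=> rg mg t; have [phi [psi [[p Ep] [q Eq] q0 E]]] := rg t.
have p0 : p = 0.
  by apply: poly_many0; apply: many_sub mg => x gx; rewrite -Ep -E gx mulr0.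
have := E t; rewrite Ep p0 horner0 => /eqP.
by rewrite mulf_eq0 (negPf q0) => /eqP.
Qed.

End FunctionAlgebras.

(** * A basis extracted from a family of vectors *)

Lemma bounded_max (P : nat -> Prop) b : P 0%N -> (forall k, P k -> (k <= b)%N) ->
  exists k, P k /\ forall j, P j -> (j <= k)%N.
Proof.
move=> P0 Pb; have [k kP kmax] := @ex_maxnP (fun k => `[< P k >]) b
  (ex_intro _ 0%N (introT (asboolP _) P0)) (fun k h => Pb k (elimT (asboolP _) h)).
by exists k; split; [exact/asboolP | move=> j Pj; apply: kmax; exact/asboolP].
Qed.

Lemma nat_least (P : nat -> Prop) : (exists k, P k) ->
  exists k, P k /\ forall j, P j -> (k <= j)%N.
Proof.
move=> [k0 Pk0]; have ex : exists k, `[< P k >] by exists k0; exact/asboolP.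
case: (ex_minnP ex) => k kP kmin.
by exists k; split; [exact/asboolP | move=> j Pj; apply: kmin; exact/asboolP].
Qed.

(** Stack as many vectors of [W] as increase the rank.  As long as the rank is
    not full, a nonzero covector kills all rows; it does not kill all of [W], so
    another row can be added. *)
Lemma unitmx_of_rows (F : fieldType) N (W : 'rV[F]_N -> Prop) :
  (forall c : 'cV[F]_N, (forall w, W w -> w *m c = 0) -> c = 0) ->
  exists M : 'M[F]_N, M \in unitmx /\ forall i, W (row i M).
Proof.
move=> Wc.
pose P r := exists k (A : 'M[F]_(k, N)), \rank A = r /\ forall i, W (row i A).
have [||r [[k [A [rA WA]]] rmax]] := @bounded_max P N.
- by exists 0%N, 0; rewrite mxrank0; split => // -[].
- by move=> _ [k [A [<- _]]]; exact: rank_leq_col.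
have fA : row_full A.
  apply: contrapT => /negP nf.
  have [j cj] : exists j, col j (cokermx A) != 0.
    apply: contrapT => nj; case/negP: nf; rewrite -sub1mx submxE mul1mx.
    apply/eqP/matrixP => i j; have /negP := contra_not (fun h => ex_intro _ j h) nj.
    by rewrite negbK => /eqP/matrixP/(_ i 0); rewrite !mxE.
  have /existsNP[w /not_implyP[Ww wc]] :
      ~ (forall w, W w -> w *m col j (cokermx A) = 0).
    by move=> /Wc h; rewrite h eqxx in cj.
  have : (\rank (col_mx w A) <= r)%N.
    apply: rmax; exists (1 + k)%N, (col_mx w A); split => // i.
    rewrite -[i]splitK; case: (split i) => i' /=; last by rewrite rowKd.
    by rewrite rowKu (ord1 i') row_id.
  have sA : (A <= col_mx w A)%MS by rewrite -addsmxE addsmxSr.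
  rewrite -rA (geq_leqif (mxrank_leqif_sup sA)) => h; apply: wc.
  have : (w <= A)%MS by apply: submx_trans h; rewrite -addsmxE addsmxSl.
  by rewrite submxE colE mulmxA => /eqP ->; rewrite mul0mx.
exists (rowsub (fullrankfun fA) A); split; first exact: fullrowsub_unit.
by move=> i; rewrite row_rowsub.
Qed.

(** * The degree of a rational function of one variable *)

Lemma size_mul_gt1 (D : idomainType) (r k : {poly D}) n :
  (1 < size k)%N -> (size (r * k)%R <= n.+1)%N -> (size r <= n)%N.
Proof.
move=> sk; have [->|r0] := eqVneq r 0; first by rewrite size_poly0.
have k0 : k != 0 by rewrite -size_poly_gt0; lia.
by rewrite size_mul //; lia.
Qed.

Lemma ltn_size_mul (D : idomainType) (r k : {poly D}) :
  (1 < size k)%N -> r * k != 0 -> (size r < size (r * k)%R)%N.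
Proof.
move=> sk; rewrite mulf_eq0 negb_or => /andP[r0 k0].
by rewrite size_mul //; have := r0; rewrite -size_poly_gt0; lia.
Qed.

Section Degree.
Variable R : realType.
Implicit Types (g : R -> R) (p q : {poly R}) (d : nat).

(** The degree is taken on the projective line: the larger of the degrees of
    numerator and denominator in lowest terms. *)
Definition degle d g := exists p q,
  [/\ (p != 0) || (q != 0), (size p <= d.+1)%N, (size q <= d.+1)%N &
      forall t, q.[t] * g t = p.[t]].

Lemma degle_leq d d' g : (d <= d')%N -> degle d g -> degle d' g.
Proof.
move=> dd' [p [q [pq sp sq E]]]; exists p, q; split => //.
  exact: leq_trans sp _.
exact: leq_trans sq _.
Qed.

Lemma degle_cst d c : degle d (fun=> c).
Proof.
exists c%:P, 1; split; rewrite ?oner_eq0 ?orbT ?size_poly1 //.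
  by rewrite (leq_trans (size_polyC_leq1 _)).
by move=> t; rewrite !hornerE.
Qed.

(** The value [y] of [p / q] at [t] is one linear condition on the vector of
    coefficients of [p] and [q]; this is its row. *)
Definition obs d (t y : R) : 'rV[R]_(d.+1 + d.+1) :=
  row_mx (\row_i t ^+ i) (\row_i - (y * t ^+ i)).

Definition numer d (c : 'cV[R]_(d.+1 + d.+1)) : {poly R} := rVpoly (usubmx c)^T.
Definition denom d (c : 'cV[R]_(d.+1 + d.+1)) : {poly R} := rVpoly (dsubmx c)^T.

Lemma horner_rV n (v : 'rV[R]_n) t : (rVpoly v).[t] = \sum_(i < n) v 0 i * t ^+ i.
Proof.
rewrite (@horner_coef_wide _ n) ?size_poly //.
by apply: eq_bigr => i _; rewrite coef_rVpoly_ord.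
Qed.

Lemma obs_mul d t y c : (obs d t y *m c) 0 0 = (numer c).[t] - y * (denom c).[t].
Proof.
rewrite -[in LHS](vsubmxK c) mul_row_col mxE !horner_rV mulr_sumr -sumrN.
by congr (_ + _); rewrite mxE; apply: eq_bigr => i _; rewrite !mxE; ring.
Qed.

Lemma obs_mul0 d t y c : obs d t y *m c = 0 <-> (denom c).[t] * y = (numer c).[t].
Proof.
split => [h|h]; first have /eqP := obs_mul t y c.
  by rewrite h mxE eq_sym subr_eq0 mulrC => /eqP.
by apply/matrixP => i j; rewrite !ord1 obs_mul -h mxE; ring.
Qed.

Lemma numer_denom_eq0 d (c : 'cV[R]_(d.+1 + d.+1)) :
  numer c = 0 -> denom c = 0 -> c = 0.
Proof.
move=> /(congr1 (poly_rV (d:=d.+1))) + /(congr1 (poly_rV (d:=d.+1))).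
rewrite !rVpolyK !raddf0 => /(congr1 trmx) + /(congr1 trmx); rewrite !trmxK !trmx0.
by move=> u0 d0; rewrite -(vsubmxK c) u0 d0 col_mx0.
Qed.

Definition pqcol d p q : 'cV[R]_(d.+1 + d.+1) :=
  col_mx (poly_rV p)^T (poly_rV q)^T.

Lemma numerK d p q : (size p <= d.+1)%N -> numer (pqcol d p q) = p.
Proof. by move=> sp; rewrite /numer col_mxKu trmxK poly_rV_K. Qed.

Lemma denomK d p q : (size q <= d.+1)%N -> denom (pqcol d p q) = q.
Proof. by move=> sp; rewrite /denom col_mxKd trmxK poly_rV_K. Qed.

Lemma numerB d (b c : 'cV[R]_(d.+1 + d.+1)) : numer (b - c) = numer b - numer c.
Proof. by rewrite /numer !raddfB. Qed.

Lemma denomB d (b c : 'cV[R]_(d.+1 + d.+1)) : denom (b - c) = denom b - denom c.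
Proof. by rewrite /denom !raddfB. Qed.

Lemma numerZ d a (c : 'cV[R]_(d.+1 + d.+1)) : numer (a *: c) = a *: numer c.
Proof. by rewrite /numer !linearZ. Qed.

Lemma denomZ d a (c : 'cV[R]_(d.+1 + d.+1)) : denom (a *: c) = a *: denom c.
Proof. by rewrite /denom !linearZ. Qed.

Definition sample d g (ts : 'I_(d.+1 + d.+1) -> R) : 'M[R]_(d.+1 + d.+1) :=
  \matrix_i obs d (ts i) (g (ts i)).

Lemma sample_mul0 d g ts c : (forall i, (denom c).[ts i] * g (ts i) = (numer c).[ts i]) ->
  @sample d g ts *m c = 0.
Proof.
by move=> E; apply/row_matrixP => i; rewrite row_mul rowK row0; apply/obs_mul0.
Qed.

Lemma degle_det d g ts : degle d g -> \det (@sample d g ts) = 0.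
Proof.
move=> [p [q [pq sp sq E]]]; apply/eqP/negP => /negP dn.
have u : sample g ts \in unitmx by rewrite unitmxE unitfE.
have : sample g ts *m pqcol d p q = 0.
  by apply: sample_mul0 => i; rewrite numerK // denomK.
move/(congr1 (mulmx (invmx (sample g ts)))); rewrite mulKmx // mulmx0 => c0.
have /negP := pq; apply.
have -> : p = 0 by rewrite -(numerK q sp) c0 /numer !linear0.
have -> : q = 0 by rewrite -(denomK p sq) c0 /denom !linear0.
by rewrite eqxx.
Qed.

(** If no [p, q] satisfied all conditions, some square family of conditions
    would already be independent. *)
Lemma det_degle d g :
  (forall ts, \det (@sample d g ts) = 0) -> degle d g.
Proof.
move=> dets; apply: contrapT => nd.
have [|M [uM MP]] := @unitmx_of_rows R _ (fun w => exists t, w = obs d t (g t)).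
  move=> c cP; apply: contrapT => cn0; apply: nd; exists (numer c), (denom c).
  split; rewrite ?size_poly //.
    apply: contra_notT cn0; rewrite negb_or !negbK => /andP[/eqP n0 /eqP d0].
    exact: numer_denom_eq0.
  by move=> t; apply/obs_mul0/cP; exists t.
have [ts tsP] := choice MP; have := dets ts.
have -> : sample g ts = M by apply/row_matrixP => i; rewrite rowK tsP.
by move/eqP; move: uM; rewrite unitmxE unitfE => /negPf ->.
Qed.

(** The semicontinuity principle that drives all perturbation arguments:
    the determinants are regular in the parameter [m] and vanish for infinitely
    many [m]. *)
Lemma degle_family d (h : R -> R -> R) :
  (forall t m, regat (@poly1 R) (h^~ t) m) ->
  many (fun m => degle d (h m)) -> forall m, degle d (h m).
Proof.
move=> rh mh m; apply: det_degle => ts.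
apply: (@regat1_many0 R (fun m => \det (sample (h m) ts))).
  move=> m'; have al := funalg_regat m' (funalg_poly1 R); apply: (@funalg_det _ _ _ _ (fun m => sample (h m) ts) al).
  move=> i j; rewrite /sample /obs.
  have [j'|j'] := split_ordP j => ->.
    by under eq_fun do rewrite mxE row_mxEl mxE; exact: (funalg_cst al).
  under eq_fun do rewrite mxE row_mxEr mxE -mulrN.
  by apply: (funalg_mul al); [exact: rh | exact: (funalg_cst al)].
by apply: many_sub mh => m' dm; exact: degle_det.
Qed.

(** When [D] is the exact degree, the fraction [p0 / q0] is in lowest terms
    and at least one of its terms has full size, so that another solution of
    the linear conditions can only be a constant multiple.  A common zero of
    [p0] and [q0] would allow a simplification, hence [q0] has no zero. *)
Lemma degle_exact D g : (forall t, regat (@poly1 R) g t) ->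
  degle D g -> (forall d, degle d g -> (D <= d)%N) ->
  exists p0 q0, [/\ (size p0 <= D.+1)%N, (size q0 <= D.+1)%N,
    (forall t, q0.[t] * g t = p0.[t]), (forall t, q0.[t] != 0) &
    forall p q, (size p <= D.+1)%N -> (size q <= D.+1)%N ->
      many (fun t => q.[t] * g t = p.[t]) ->
      exists h : R, p = h *: p0 /\ q = h *: q0].
Proof.
move=> rg [p0 [q0 [pq sp sq E]]] Dmin.
(* a smaller solution would contradict the minimality of [D] *)
have small p q : (p != 0) || (q != 0) -> (size p <= D)%N -> (size q <= D)%N ->
    (forall t, q.[t] * g t = p.[t]) -> False.
  case: D Dmin {sp sq} => [|D] Dmin pq' sp' sq' E'.
    by move: pq' sp' sq'; rewrite !leqn0 !size_poly_eq0 => /orP[] /negPf ->.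
  suff /Dmin : degle D g by rewrite ltnn.
  by exists p, q.
have cop : coprimep p0 q0.
  apply: contrapT; rewrite /coprimep => /negP k1.
  have k0 : gcdp p0 q0 != 0 by rewrite gcdp_eq0 negb_and.
  have [p1 Ep] := dvdpP _ _ (dvdp_gcdl p0 q0).
  have [q1 Eq] := dvdpP _ _ (dvdp_gcdr p0 q0).
  have sk : (1 < size (gcdp p0 q0))%N by rewrite ltn_neqAle eq_sym k1 size_poly_gt0.
  have szD (r r1 : {poly R}) : (size r <= D.+1)%N -> r = r1 * gcdp p0 q0 -> (size r1 <= D)%N.
    move=> sr Er; 
    by apply: (size_mul_gt1 sk); rewrite -Er.
  apply: (small p1 q1); [|exact: (szD _ _ sp Ep)|exact: (szD _ _ sq Eq)|].
    apply: contraLR pq; rewrite !negb_or !negbK => /andP[/eqP p10 /eqP q10].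
    by rewrite Ep Eq p10 q10 !mul0r eqxx.
  move=> t; apply/eqP; rewrite -subr_eq0; apply/eqP; move: t.
  apply: regat1_many0 => [t|].
    have al := funalg_regat t (funalg_poly1 R).
    apply: (funalg_add al); [apply: (funalg_mul al) => //|].
      by apply: regat_id; [exact: funalg_poly1|exists q1].
    apply: regat_id; [exact: funalg_poly1|exists (- p1) => x]. 
    by rewrite hornerN.
  apply: many_sub (many_root k0) => t kt; apply/(mulIf kt).
  by have := E t; rewrite {1}Ep {1}Eq !hornerM => Et; rewrite mul0r mulrBl -Et; ring.
have q0t t : q0.[t] != 0.
  apply/negP => /eqP q00; have := E t; rewrite q00 mul0r => /esym/eqP p00.
  by have := coprimep_root cop p00; rewrite q00 eqxx.
have q00 : q0 != 0 by apply/eqP => q00; have := q0t 0; rewrite q00 horner0 eqxx.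
exists p0, q0; split => // p q sp' sq' mE.
have X : q * p0 = q0 * p.
  apply: poly_ext; apply: many_sub mE => t Et; rewrite !hornerM -E -Et; ring.
have /dvdpP[h Eh] : q0 %| q.
  by rewrite -(Gauss_dvdpl _ (_ : coprimep q0 p0)) ?X ?dvdp_mulr // coprimep_sym.
have Ep : p = h * p0.
  by apply: (mulfI q00); rewrite -X Eh; ring.
have : (size h <= 1)%N.
  have [->|h0] := eqVneq h 0; first by rewrite size_poly0.
  rewrite leqNgt; apply/negP => sh; apply: (small p0 q0) => //.
    have [->|p00] := eqVneq p0 0; first by rewrite size_poly0.
    by apply: (size_mul_gt1 sh); rewrite mulrC -Ep.
  by apply: (size_mul_gt1 sh); rewrite mulrC -Eh.
move/size1_polyC => hE; exists h`_0.
by rewrite -!mul_polyC -hE.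
Qed.

(** The cofactors along row [i0] do not depend on that row, and they form a
    vector killed by the other rows. *)
Definition cofcol N (A : 'M[R]_N) i0 : 'cV[R]_N := \col_j cofactor A i0 j.

Lemma eq_cofcol N (A B : 'M[R]_N) i0 :
  (forall i, i != i0 -> row i A = row i B) -> cofcol A i0 = cofcol B i0.
Proof.
move=> AB; apply/matrixP => j k; rewrite !mxE /cofactor; congr (_ * \det _).
apply/matrixP => i l; rewrite !mxE.
have ne : lift i0 i != i0 by rewrite eq_sym neq_lift.
by have /rowP/(_ (lift j l)) := AB _ ne; rewrite !mxE.
Qed.

Lemma row_cofcol N (A : 'M[R]_N) i0 : (row i0 A *m cofcol A i0) 0 0 = \det A.
Proof.
by rewrite (expand_det_row _ i0) mxE; apply: eq_bigr => j _; rewrite !mxE.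
Qed.

(** The determinant with row [i0] replaced by the condition at [t] vanishes by
    [degle_det]; expand it along that row. *)
Lemma cramer_generic d g ts i0 : degle d g ->
  let c := cofcol (@sample d g ts) i0 in
  forall t, (denom c).[t] * g t = (numer c).[t].
Proof.
move=> dg c t; apply/obs_mul0.
pose ts' i := if i == i0 then t else ts i.
have -> : c = cofcol (sample g ts') i0.
  by apply: eq_cofcol => i ii0; rewrite !rowK /ts' (negPf ii0).
have <- : row i0 (sample g ts') = obs d t (g t) by rewrite rowK /ts' eqxx.
by apply/matrixP => i j; rewrite !ord1 row_cofcol degle_det // mxE.
Qed.

(** Add to the conditions at points of [T] the row of coefficients of the
    solution itself.  By uniqueness of the solution nothing but zero is
    orthogonal to all these rows, so some square family of them is invertible;
    it must contain the added row exactly once, at [i0]. *)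
Lemma cramer_exact D g (T : R -> Prop) : (forall t, regat (@poly1 R) g t) ->
  degle D g -> (forall d, degle d g -> (D <= d)%N) -> many T ->
  exists ts i0, (forall i, i != i0 -> T (ts i)) /\
    forall t, (denom (cofcol (@sample D g ts) i0)).[t] != 0.
Proof.
move=> rg dg Dmin mT.
have [p0 [q0 [sp sq E q0t uniq]]] := degle_exact rg dg Dmin.
pose w0 : 'cV[R]_(D.+1 + D.+1) := pqcol D p0 q0.
have q00 : q0 != 0 by apply/eqP => q00; have := q0t 0; rewrite q00 horner0 eqxx.
have colE (c : 'cV[R]_(D.+1 + D.+1)) h :
    numer c = h *: p0 -> denom c = h *: q0 -> c = h *: w0.
  move=> nc dc; apply/eqP; rewrite -subr_eq0; apply/eqP/numer_denom_eq0.
    by rewrite numerB numerZ nc numerK // subrr.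
  by rewrite denomB denomZ dc denomK // subrr.
have w00 : w0 != 0.
  apply: contra q00 => /eqP w00; rewrite -(denomK p0 sq) -/w0 w00 /denom.
  by rewrite !linear0.
(* over an ordered field a vector orthogonal to itself is zero *)
have w0w0 : w0^T *m w0 = 0 -> False.
  move=> /matrixP/(_ 0 0); rewrite !mxE => /eqP; rewrite psumr_eq0 => [/allP h|i _].
    case/negP: w00; apply/eqP/matrixP => i j; rewrite (ord1 j) [RHS]mxE.
    have := h i; rewrite mem_index_enum => /(_ isT) /=.
    by rewrite mxE mulf_eq0 orbb => /eqP.
  by rewrite mxE -expr2 sqr_ge0.
have [|M [uM MP]] := @unitmx_of_rows R _
    (fun w => (exists t, T t /\ w = obs D t (g t)) \/ w = w0^T).
  move=> c cP.
  have [h [nh dh]] : exists h, numer c = h *: p0 /\ denom c = h *: q0.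
    apply: uniq; rewrite ?size_poly //; apply: many_sub mT => t Tt.
    by apply/obs_mul0/cP; left; exists t.
  have ch := colE _ _ nh dh; have := cP w0^T (or_intror erefl).
  rewrite ch -scalemxAr => /eqP; rewrite scaler_eq0 => /orP[/eqP ->|/eqP /w0w0 //].
  by rewrite scale0r.
have [i0 i0P] : exists i0, row i0 M = w0^T /\
    ~ exists t, T t /\ row i0 M = obs D t (g t).
  apply: contrapT => ni0.
  have MO i : exists t, T t /\ row i M = obs D t (g t).
    by apply: contrapT => ni; apply: ni0; exists i; case: (MP i).
  case/negP: w00; apply/eqP; rewrite -[LHS](mulKmx uM).
  rewrite (_ : M *m w0 = 0) ?mulmx0 //; apply/row_matrixP => i.
  rewrite row_mul row0; have [t [_ ->]] := MO i.
  by apply/obs_mul0; rewrite numerK // denomK.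
have detM : \det M != 0 by rewrite -unitfE -unitmxE.
have MO i : exists t, i != i0 -> T t /\ row i M = obs D t (g t).
  have [->|ii0] := eqVneq i i0; first by exists 0.
  case: (MP i) => [[t tP]|iw]; first by exists t.
  case/eqP: detM; apply: (determinant_alternate ii0) => j.
  by have /rowP/(_ j) := etrans iw (esym i0P.1); rewrite !mxE.
have [ts tsP] := choice MO; exists ts, i0; split => [i /tsP[]//|t].
have -> : cofcol (sample g ts) i0 = cofcol M i0.
  by apply: eq_cofcol => i /tsP[_ ->]; rewrite rowK.
set c := cofcol M i0.
have [h [nh dh]] : exists h, numer c = h *: p0 /\ denom c = h *: q0.
  apply: uniq; rewrite ?size_poly //.
  have -> : c = cofcol (sample g ts) i0.
    by apply: eq_cofcol => i /tsP[_ ->]; rewrite rowK.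
  exact: (many_sub (fun t' _ => cramer_generic ts i0 dg t') (@many_true R)).
rewrite dh hornerZ mulf_neq0 //; apply/eqP => h0; case/eqP: detM.
by rewrite -(row_cofcol M i0) -/c (colE _ _ nh dh) h0 scale0r mulmx0 mxE.
Qed.

End Degree.

(** * Lowest terms for bivariate fractions *)

Section Gauss.
Variable R : realType.
Implicit Types (p q c rho pi : {poly R}) (P Q G : {poly {poly R}}).

Lemma irreducible_factor c : (1 < size c)%N -> exists pi, irreducible_poly pi /\ pi %| c.
Proof.
move=> sc.
have [n [[pi [spi pic szn]] nmin]] := @nat_least
  (fun n => exists pi, [/\ (1 < size pi)%N, pi %| c & size pi = n])
  (ex_intro _ _ (ex_intro _ c (And3 sc (dvdpp c) erefl))).
exists pi; split => //; split => // q sq qpi.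
have pi0 : pi != 0 by rewrite -size_poly_gt0; lia.
have q0 : q != 0 by apply: contraTneq qpi => ->; rewrite dvd0p.
have q1 : (1 < size q)%N by rewrite ltn_neqAle eq_sym sq size_poly_gt0.
rewrite -dvdp_size_eqp // eqn_leq dvdp_leq //= szn.
by apply: nmin; exists q; split => //; exact: dvdp_trans pic.
Qed.

(** Divisibility of the content by [pi]. *)
Definition cdvd pi P := forall i, pi %| P`_i.

Lemma cdvdP pi P : cdvd pi P -> exists Q, P = pi%:P * Q.
Proof.
move=> piP; exists (\poly_(i < size P) (P`_i %/ pi)); apply/polyP => i.
rewrite coefCM coef_poly; case: ltnP => [_|sP]; first by rewrite mulrC divpK.
by rewrite mulr0 nth_default.
Qed.

Lemma cdvd_mull pi P Q : cdvd pi P -> cdvd pi (P * Q).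
Proof.
move=> piP i; rewrite coefM; apply: (big_ind (fun x => pi %| x)); first exact: dvdp0.
  by move=> x y; exact: dvdp_add.
by move=> j _; rewrite dvdp_mulr.
Qed.

Lemma cdvdD pi P Q : cdvd pi P -> cdvd pi Q -> cdvd pi (P + Q).
Proof. by move=> piP piQ i; rewrite coefD dvdp_add. Qed.

Lemma cdvdB pi P Q : cdvd pi P -> cdvd pi Q -> cdvd pi (P - Q).
Proof. by move=> piP piQ i; rewrite coefB dvdp_sub. Qed.

Lemma irreducible_dvd_mul pi p q : irreducible_poly pi ->
  pi %| p * q -> pi %| p \/ pi %| q.
Proof.
move=> ipi pipq; have [pip|npip] := boolP (pi %| p); first by left.
right; rewrite -(Gauss_dvdpr _ (_ : coprimep pi p)) //.
apply: contraNT npip => ncop.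
have := ipi.2 _ ncop (dvdp_gcdl pi p); rewrite /eqp => /andP[_ h].
exact: dvdp_trans h (dvdp_gcdr _ _).
Qed.

(** If [pi] divides neither leading coefficient, it does not divide that of the
    product; otherwise subtract a leading term. *)
Lemma gauss_prime pi P Q : irreducible_poly pi ->
  cdvd pi (P * Q) -> cdvd pi P \/ cdvd pi Q.
Proof.
move=> ipi; have [n] := ubnP (size P + size Q); elim: n P Q => // n IH P Q szn piPQ.
have [->|P0] := eqVneq P 0; first by left => i; rewrite coef0 dvdp0.
have [->|Q0] := eqVneq Q 0; first by right => i; rewrite coef0 dvdp0.
pose tl (S : {poly {poly R}}) := S - lead_coef S *: 'X^((size S).-1).
have tlP S : S != 0 -> (size (tl S) < size S)%N.
  move=> S0; rewrite -(prednK (_ : 0 < size S)%N) ?size_poly_gt0 // ltnS.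
  apply/leq_sizeP => j; rewrite leq_eqVlt coefB coefZ coefXn => /orP[/eqP <-|lj].
    by rewrite eqxx mulr1 lead_coefE subrr.
  by rewrite gtn_eqF // mulr0 subr0 nth_default // (leq_trans (leqSpred _) lj).
have hd S : pi %| lead_coef S -> cdvd pi (lead_coef S *: 'X^((size S).-1)).
  by move=> h i; rewrite coefZ dvdp_mulr.
have tlE S : S = tl S + lead_coef S *: 'X^((size S).-1) by rewrite subrK.
have := piPQ (size (P * Q)%R).-1; rewrite -lead_coefE lead_coefM => /(irreducible_dvd_mul ipi)[] h.
  have [||h1|h1] := IH (tl P) Q.
  - by have := tlP _ P0; lia.
  - by rewrite /tl mulrBl; apply: cdvdB => //; apply: cdvd_mull; exact: hd.
  - by left; rewrite [P]tlE; apply: cdvdD => //; exact: hd.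
  - by right.
have [||h1|h1] := IH P (tl Q).
- by have := tlP _ Q0; lia.
- by rewrite /tl mulrBr; apply: cdvdB => //; rewrite mulrC; apply: cdvd_mull; exact: hd.
- by left.
- by right; rewrite [Q]tlE; apply: cdvdD => //; exact: hd.
Qed.

(** Lowest terms in two variables, that is, coprime over the fraction field of
    the coefficients (witnessed by [rho]) and without common content.  The gcd
    over the fraction field gives [c * P = G * P1] and [c * Q = G * Q1] with a
    superfluous constant [c]; each prime factor of [c] divides [G], or both [P1]
    and [Q1], and is removed accordingly.  Each step makes [c] or [rho] smaller. *)
Lemma coprime_rep P Q : Q != 0 -> exists G P1 Q1 A B rho,
  [/\ P = G * P1, Q = G * Q1, rho != 0, A * P1 + B * Q1 = rho%:P &
      forall pi, irreducible_poly pi -> ~ (cdvd pi P1 /\ cdvd pi Q1)].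
Proof.
move=> Q0.
suff gen n c rho G P1 Q1 A B : (size c + size rho < n)%N -> c != 0 -> rho != 0 ->
    c%:P * P = G * P1 -> c%:P * Q = G * Q1 -> A * P1 + B * Q1 = rho%:P ->
    exists G P1 Q1 A B rho,
    [/\ P = G * P1, Q = G * Q1, rho != 0, A * P1 + B * Q1 = rho%:P &
      forall pi, irreducible_poly pi -> ~ (cdvd pi P1 /\ cdvd pi Q1)].
  have G0 : gcdp P Q != 0 by rewrite gcdp_eq0 negb_and Q0 orbT.
  have /Pdiv.Idomain.dvdpP[[c1 P1] /= c10 EP] := dvdp_gcdl P Q.
  have /Pdiv.Idomain.dvdpP[[c2 Q1] /= c20 EQ] := dvdp_gcdr P Q.
  have [[u v] /= /eqpP[[a b] /= /andP[a0 b0] Euv]] := Pdiv.Idomain.Bezoutp P Q.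
  apply: (gen _ (c1 * c2) (c1 * c2 * b) (gcdp P Q) (c2 *: P1) (c1 *: Q1)
            (a *: u) (a *: v) (ltnSn _)).
  - by rewrite mulf_neq0.
  - by rewrite !mulf_neq0.
  - by rewrite mul_polyC [c1 * c2]mulrC -scalerA EP scalerAl mulrC.
  - by rewrite mul_polyC -scalerA EQ scalerAl mulrC.
  - apply: (mulIf G0); move: EP EQ Euv; rewrite -!mul_polyC !polyCM => EP EQ Euv.
    set g := gcdp P Q in EP EQ Euv *.
    transitivity (a%:P * (u * c2%:P * (P1 * g) + v * c1%:P * (Q1 * g))); first by ring.
    rewrite -EP -EQ; transitivity (c1%:P * c2%:P * (a%:P * (u * P + v * Q))); first by ring.
    by rewrite Euv; ring.
elim: n c rho G P1 Q1 A B => // n IH c rho G P1 Q1 A B szn c0 rho0 EP EQ E.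
have [[pi [ipi [/cdvdP[P2 E1] /cdvdP[Q2 E2]]]]|none] :=
    pselect (exists pi, irreducible_poly pi /\ (cdvd pi P1 /\ cdvd pi Q1)).
  have pi0 := irredp_neq0 ipi.
  have EE : pi%:P * (A * P2 + B * Q2) = rho%:P by rewrite -E E1 E2; ring.
  have Erho : pi * (A * P2 + B * Q2)`_0 = rho.
    by have := congr1 (fun S : {poly {poly R}} => S`_0) EE; rewrite coefCM coefC.
  have rho'0 : (A * P2 + B * Q2)`_0 != 0.
    by apply: contraNneq rho0 => r0; rewrite -Erho r0 mulr0.
  apply: (IH c (A * P2 + B * Q2)`_0 (G * pi%:P) P2 Q2 A B) => //.
  - rewrite -ltnS (leq_trans _ szn) // ltnS ltn_add2l.
    have := @ltn_size_mul _ (A * P2 + B * Q2)`_0 pi ipi.1.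
    by rewrite [_ * pi]mulrC Erho; apply.
  - by rewrite EP E1 mulrA.
  - by rewrite EQ E2 mulrA.
  - apply/polyP => i; apply: (mulfI pi0); rewrite -coefCM EE !coefC.
    by case: eqP => // _; rewrite mulr0.
have [sc|sc] := ltnP 1 (size c).
  have [pi [ipi /dvdpP[c' Ec]]] := irreducible_factor sc.
  have pi0 := irredp_neq0 ipi.
  have cpi S : cdvd pi (c%:P * S).
    by apply: cdvd_mull => i; rewrite coefC Ec; case: eqP => // _; rewrite ?dvdp_mull ?dvdp0.
  have [/cdvdP[G' EG]|pi1] : cdvd pi G \/ cdvd pi P1 /\ cdvd pi Q1.
    have := cpi P; have := cpi Q; rewrite EP EQ => /(gauss_prime ipi)[|q1]; first by left.
    by move=> /(gauss_prime ipi)[|p1]; [left|right].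
  - have piP0 : pi%:P != 0 :> {poly {poly R}} by rewrite polyC_eq0.
    have c'0 : c' != 0 by apply: contraNneq c0 => c'0; rewrite Ec c'0 mul0r.
    apply: (IH c' rho G' P1 Q1 A B) => //.
    + rewrite -ltnS (leq_trans _ szn) // ltnS ltn_add2r.
      by have := @ltn_size_mul _ c' pi ipi.1; rewrite -Ec; apply.
    + by apply: (mulfI piP0); rewrite !mulrA -EG -EP -polyCM [pi * _]mulrC Ec.
    + by apply: (mulfI piP0); rewrite !mulrA -EG -EQ -polyCM [pi * _]mulrC Ec.
  - by case: none; exists pi.
have [a Ea] : exists a : R, c = a%:P by exists c`_0; exact: size1_polyC.
have a0 : a != 0 by apply: contraNneq c0 => a0; rewrite Ea a0.
have aV S : (a^-1%:P)%:P * (c%:P * S) = S.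
  by rewrite mulrA Ea -!polyCM mulVf // mul1r.
exists ((a^-1%:P)%:P * G), P1, Q1, A, B, rho; split => //.
- by rewrite -mulrA -EP aV.
- by rewrite -mulrA -EQ aV.
- by move=> pi ipi h; apply: none; exists pi.
Qed.

End Gauss.

(** * The pencil of lines through a point of a plane *)

Section Pencil.
Variable R : realType.
Implicit Types (p q c rho pi : {poly R}) (P Q G : {poly {poly R}}).

Lemma many_or (A B : R -> Prop) : many (fun x => A x \/ B x) -> many A \/ many B.
Proof.
move=> mAB; have [mA|nA] := pselect (many A); [by left|right].
have [s sA] := few_seq nA.
by apply: many_sub (many_notin s mAB) => x [xs [/sA|//]]; rewrite (negPf xs).
Qed.

Lemma horner_horner P p t : P.[p].[t] = P.[(p.[t])%:P].[t].
Proof.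
rewrite !(horner_coef P) !horner_sum; apply: eq_bigr => i _.
by rewrite !hornerM !horner_exp hornerC.
Qed.

(** On the line of slope [m], [P] restricts to [P.[m *: 'X]], which is
    polynomial in [m] with coefficients [P`_j * 'X^j].  So a linear condition
    that holds for infinitely many slopes holds for each of these
    coefficients. *)
Lemma slope_linear (l : {poly R} -> R) P :
  (forall a p q, l (a *: p + q) = a * l p + l q) ->
  many (fun m => l P.[m *: 'X] = 0) -> forall j, l (P`_j * 'X^j) = 0.
Proof.
move=> lin ml.
have l0 : l 0 = 0.
  have := lin 1 0 0; rewrite scale1r addr0 mul1r => /eqP.
  by rewrite eq_sym addrC -subr_eq0 addrK => /eqP.
pose T := \poly_(j < size P) l (P`_j * 'X^j).
have TE m : T.[m] = l P.[m *: 'X].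
  rewrite horner_poly horner_coef.
  rewrite (big_morph l (id1 := 0) (op1 := +%R)) //; last first.
    by move=> p q; have := lin 1 p q; rewrite scale1r mul1r.
  apply: eq_bigr => j _; rewrite exprZn -scalerAr.
  by have := lin (m ^+ j) (P`_j * 'X^j) 0; rewrite !addr0 l0 addr0 => ->; rewrite mulrC.
have T0 : T = 0 by apply: poly_many0; apply: many_sub ml => m; rewrite TE.
move=> j; have := congr1 (fun p : {poly R} => p`_j) T0; rewrite coef_poly coef0.
by case: ltnP => // sj; rewrite nth_default // mul0r.
Qed.

Lemma slope_size P k : many (fun m => (size P.[m *: 'X] <= k)%N) ->
  forall j, (size (P`_j * 'X^j)%R <= k)%N.
Proof.
move=> ms j; apply/leq_sizeP => i ki.
apply: (@slope_linear (fun p => p`_i)); first by move=> a p q; rewrite coefD coefZ.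
by apply: many_sub ms => m /leq_sizeP ->.
Qed.

Lemma slope_dvd P pi : many (fun m => pi %| P.[m *: 'X]) ->
  forall j, pi %| P`_j * 'X^j.
Proof.
move=> md j; rewrite /dvdp; apply/eqP/polyP => i; rewrite coef0.
apply: (@slope_linear (fun p => (p %% pi)`_i)).
  by move=> a p q; rewrite modpD modpZl coefD coefZ.
by apply: many_sub md => m; rewrite /dvdp => /eqP ->; rewrite coef0.
Qed.

Lemma poly2_eq0 P : (forall s t, P.[t%:P].[s] = 0) -> P = 0.
Proof.
move=> P0; apply/polyP => j; rewrite coef0; apply/polyP => i; rewrite coef0.
have := @slope_linear (fun p => p`_(i + j)) P _ _ j; rewrite coefMXn.
rewrite ltnNge leq_addl /= addnK; apply; first by move=> a p q; rewrite coefD coefZ.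
apply: many_sub (@many_true R) => m _; suff -> : P.[m *: 'X] = 0 by rewrite coef0.
apply: poly_many0; apply: many_sub (@many_true R) => t _.
by rewrite horner_horner.
Qed.

Lemma regat2_eq0 (h : R * R -> R) G : G != 0 ->
  (forall x, regat (@poly2 R) h x) ->
  (forall x, G.[x.2%:P].[x.1] * h x = 0) -> forall x, h x = 0.
Proof.
move=> G0 rh Gh x; have [phi [psi [[P EP] [Q EQ] Qx E]]] := rh x.
have P0 : P = 0.
  apply: (mulfI G0); rewrite mulr0; apply: poly2_eq0 => s t.
  rewrite !hornerM; have := E (s, t); rewrite EP /= => <-.
  by have := Gh (s, t) => /= Ghst; rewrite mulrCA Ghst mulr0.
have := E x; rewrite EP P0 !horner0 => /eqP.
by rewrite mulf_eq0 (negPf Qx) => /eqP.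
Qed.

(** There are finitely many prime factors of [rho] to consider.  A prime [pi] that works for infinitely many slopes
    divides each [P`_j * 'X^j] and [Q`_j * 'X^j]; it is prime to ['X] as [Q] does
    not vanish at the origin, and so would divide the contents. *)
Lemma few_common_factors P Q rho : (Q.[0].[0] != 0) -> rho != 0 ->
  (forall pi, irreducible_poly pi -> ~ (cdvd pi P /\ cdvd pi Q)) ->
  ~ many (fun m => exists pi, irreducible_poly pi /\
     [/\ pi %| rho, pi %| P.[m *: 'X] & pi %| Q.[m *: 'X]]).
Proof.
move=> Q0 + none; have [n] := ubnP (size rho); elim: n rho => // n IH rho szn rho0 mbad.
have [sr|sr] := leqP (size rho) 1.
  have [m _ [pi [ipi [pirho _ _]]]] := mbad [::].
  by have := leq_trans (leq_trans ipi.1 (dvdp_leq rho0 pirho)) sr.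
have [pi0 [ipi0 /dvdpP[rho' Erho]]] := irreducible_factor sr.
have rho'0 : rho' != 0 by apply: contraNneq rho0 => r0; rewrite Erho r0 mul0r.
have {mbad} [mA|] : many (fun m => pi0 %| P.[m *: 'X] /\ pi0 %| Q.[m *: 'X]) \/
   many (fun m => exists pi, irreducible_poly pi /\
     [/\ pi %| rho', pi %| P.[m *: 'X] & pi %| Q.[m *: 'X]]).
- apply: many_or; apply: many_sub mbad => m [pi [ipi [+ piP piQ]]].
  rewrite Erho => /(irreducible_dvd_mul ipi)[pir|pipi0].
    by right; exists pi.
  left; have pine : size pi != 1%N by rewrite gtn_eqF // ipi.1.
  by have := ipi0.2 _ pine pipi0; rewrite /eqp => /andP[_ h];
    split; exact: dvdp_trans h _.
- have cop : coprimep pi0 'X.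
    rewrite coprimepX; apply/negP => r0; have [m _ [_ piQ]] := mA [::].
    have := root_dvdp piQ r0.
    by rewrite /root horner_horner hornerZ hornerX mulr0 (negPf Q0).
  have cd S : many (fun m => pi0 %| S.[m *: 'X]) -> cdvd pi0 S.
    move=> mS j; have := slope_dvd mS j.
    by rewrite Gauss_dvdpl // coprimep_expr.
  by apply: (none _ ipi0); split; apply: cd; apply: many_sub mA => m [].
- apply: IH => //; rewrite -ltnS (leq_trans _ szn) // ltnS.
  by have := @ltn_size_mul _ rho' pi0 ipi0.1; rewrite -Erho; apply.
Qed.

(** Write [g = P1 / Q1] in lowest terms.  As [g] is regular at the origin,
    [Q1] does not vanish there, and the restriction to a general line through
    the origin stays in lowest terms: the degree hypothesis bounds the total
    degrees of [P1] and [Q1], hence the degree on every other line.  The line of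
    ordinate 1 represents any line that misses the origin. *)
Lemma pencil_degle (g : R * R -> R) d : (forall x, regat (@poly2 R) g x) ->
  (forall m, degle d (fun t => g (t, m * t))) -> degle d (fun s => g (s, 1)).
Proof.
move=> rg dg; have [phi [psi [[P EP] [Q EQ] Qx E]]] := rg (0, 0).
rewrite EQ /= in Qx.
have Q0 : Q != 0 by apply: contraNneq Qx => ->; rewrite !horner0.
have [G [P1 [Q1 [A [B [rho [EP1 EQ1 rho0 Erho none]]]]]]] := coprime_rep P Q0.
have Q1x : Q1.[0].[0] != 0.
  by apply: contraNneq Qx => Q10; rewrite EQ1 !hornerM Q10 mulr0.
have G0 : G != 0 by apply: contraNneq Q0 => G0; rewrite EQ1 G0 mul0r.
have {}E s t : Q1.[t%:P].[s] * g (s, t) = P1.[t%:P].[s].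
  apply/eqP; rewrite -subr_eq0; apply/eqP.
  apply: (@regat2_eq0 (fun x => Q1.[x.2%:P].[x.1] * g x - P1.[x.2%:P].[x.1])
    G G0 _ _ (s, t)) => x.
    have al := funalg_regat x (funalg_poly2 R); apply: (funalg_add al).
      apply: (funalg_mul al) => //; apply: regat_id; first exact: funalg_poly2.
      by exists Q1.
    apply: regat_id; first exact: funalg_poly2.
    by exists (- P1) => y; rewrite !hornerN.
  have := E x; rewrite EP EQ EP1 EQ1 !hornerM => Ex.
  by rewrite mulrBr mulrA Ex subrr.
have Em m t : (Q1.[m *: 'X]).[t] * g (t, m * t) = (P1.[m *: 'X]).[t].
  by rewrite !(horner_horner _ (m *: 'X)) hornerZ hornerX E.
have good : many (fun m => coprimep P1.[m *: 'X] Q1.[m *: 'X]).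
  have [s sP] := few_seq (few_common_factors Q1x rho0 none).
  apply: many_sub (many_notin s (@many_true R)) => m [ms _].
  apply: contraNT ms => ncop; apply: sP.
  have Q1m : Q1.[m *: 'X] != 0.
    apply: contraNneq Q1x => Q1m; have := horner_horner Q1 (m *: 'X) 0.
    by rewrite Q1m hornerZ hornerX mulr0 horner0 => <-.
  have gm : gcdp P1.[m *: 'X] Q1.[m *: 'X] != 0 by rewrite gcdp_eq0 negb_and Q1m orbT.
  have [|pi [ipi pig]] := @irreducible_factor R (gcdp P1.[m *: 'X] Q1.[m *: 'X]).
    by rewrite ltn_neqAle eq_sym ncop size_poly_gt0.
  exists pi; split => //.
  have piP := dvdp_trans pig (dvdp_gcdl _ _).
  have piQ := dvdp_trans pig (dvdp_gcdr _ _).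
  split => //; rewrite -[rho](hornerC _ (m *: 'X)) -Erho hornerD !hornerM.
  by rewrite dvdp_add // dvdp_mull.
have sz : many (fun m => (size P1.[m *: 'X] <= d.+1)%N /\ (size Q1.[m *: 'X] <= d.+1)%N).
  apply: many_sub good => m cop.
  have [p [q [pq sp sq Epq]]] := dg m.
  have X : q * P1.[m *: 'X] = p * Q1.[m *: 'X].
    apply: poly_ext; apply: many_sub (@many_true R) => t _.
    by rewrite !hornerM -Em -Epq; ring.
  have Q1m : Q1.[m *: 'X] != 0.
    apply: contraNneq Q1x => Q1m; have := horner_horner Q1 (m *: 'X) 0.
    by rewrite Q1m hornerZ hornerX mulr0 horner0 => <-.
  have q0 : q != 0.
    apply: contraTneq pq => q0; move: X; rewrite q0 mul0r => /esym/eqP.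
    by rewrite mulf_eq0 (negPf Q1m) orbF negb_or !negbK eqxx => ->.
  have /dvdpP[h Eh] : Q1.[m *: 'X] %| q.
    rewrite -(Gauss_dvdpl _ (_ : coprimep Q1.[m *: 'X] P1.[m *: 'X])) ?X ?dvdp_mull //.
    by rewrite coprimep_sym.
  have h0 : h != 0 by apply: contraNneq q0 => h0; rewrite Eh h0 mul0r.
  have Ep : p = h * P1.[m *: 'X].
    by apply: (mulIf Q1m); rewrite -X Eh; ring.
  split; last by apply: leq_trans sq; rewrite Eh dvdp_leq ?mulf_neq0 // dvdp_mull.
  have [->|P1m] := eqVneq P1.[m *: 'X] 0; first by rewrite size_poly0.
  by apply: leq_trans sp; rewrite Ep dvdp_leq ?mulf_neq0 // dvdp_mull.
have szc (S : {poly {poly R}}) : many (fun m => (size S.[m *: 'X] <= d.+1)%N) -> (size S.[1%R] <= d.+1)%N.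
  move=> mS; rewrite horner_coef; apply: (leq_trans (size_sum _ _ _)).
  apply/bigmax_leqP => j _; rewrite expr1n mulr1.
  have [->|Sj] := eqVneq S`_j 0; first by rewrite size_poly0.
  by have := slope_size mS j; rewrite size_mulXn //; apply: leq_trans; rewrite leq_addl.
exists P1.[1], Q1.[1]; split.
- apply: contraNT rho0; rewrite negb_or !negbK => /andP[/eqP p0 /eqP q0].
  by rewrite -[rho](hornerC _ 1) -Erho hornerD !hornerM p0 q0 !mulr0 addr0.
- by apply: szc; apply: many_sub sz => m [].
- by apply: szc; apply: many_sub sz => m [].
- by move=> t; rewrite -E.
Qed.
End Pencil.

(** * Degrees along the lines of space *)

Section Dot.
Variables (R : realType) (n : nat).
Implicit Types x y z u v w : 'rV[R]_n.

Definition dot x y := \sum_i x ord0 i * y ord0 i.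

Lemma dotC x y : dot x y = dot y x.
Proof. by apply: eq_bigr => i _; rewrite mulrC. Qed.

Lemma dotDr x y z : dot x (y + z) = dot x y + dot x z.
Proof. by rewrite -big_split; apply: eq_bigr => i _; rewrite mxE mulrDr. Qed.

Lemma dotZr x a y : dot x (a *: y) = a * dot x y.
Proof. by rewrite mulr_sumr; apply: eq_bigr => i _; rewrite mxE mulrCA. Qed.

Lemma dotDl x y z : dot (x + y) z = dot x z + dot y z.
Proof. by rewrite ![dot _ z]dotC dotDr. Qed.

Lemma dotZl x a y : dot (a *: x) y = a * dot x y.
Proof. by rewrite ![dot _ y]dotC dotZr. Qed.

Lemma dot0r x : dot x 0 = 0.
Proof. by rewrite -(scale0r x) dotZr mul0r. Qed.

Lemma dotNr x y : dot x (- y) = - dot x y.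
Proof. by rewrite -scaleN1r dotZr mulN1r. Qed.

Definition dotE := (dotDr, dotDl, dotZr, dotZl, dotNr, dot0r).

Lemma dot_eq0 x : (dot x x == 0) = (x == 0).
Proof.
apply/eqP/eqP => [h|->]; last by rewrite dot0r.
apply/rowP => i; rewrite mxE; apply/eqP.
have /eqP := h; rewrite psumr_eq0 => [/allP/(_ i (mem_index_enum _))|j _].
  by rewrite /= -expr2 sqrf_eq0.
by rewrite -expr2 sqr_ge0.
Qed.

Lemma dot_neq0 x : x != 0 -> dot x x != 0.
Proof. by rewrite dot_eq0. Qed.

Lemma orth2 x y : (3 <= n)%N -> exists v, [/\ v != 0, dot v x = 0 & dot v y = 0].
Proof.
move=> n3; pose A := (col_mx x y)^T.
have: kermx A != 0.
  by rewrite -mxrank_eq0 mxrank_ker -lt0n subn_gt0 (leq_trans _ n3) // ltnS rank_leq_col.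
case/rowV0Pn => v /sub_kermxP vA v0; exists v.
have dotM z : dot v z = (v *m z^T) 0 0.
  by rewrite mxE; apply: eq_bigr => i _; rewrite mxE.
move: vA; rewrite /A tr_col_mx mul_mx_row => /eqP.
rewrite row_mx_eq0 => /andP[/eqP vx /eqP vy].
by rewrite !dotM vx vy mxE.
Qed.

Definition indep u v := forall a b : R, a *: u + b *: v = 0 -> a = 0 /\ b = 0.

Lemma indep_free u v : indep u v <-> free [:: u; v].
Proof.
split=> [i|]; last first.
  rewrite free_cons seq1_free span_seq1 => /andP[/negP nu v0] a b E.
  have a0 : a = 0.
    apply: contrapT => /eqP a0; apply: nu; apply/vlineP; exists (- (a^-1 * b)).
    apply: (scalerI a0); rewrite scalerA mulrN mulrA mulfV // mul1r scaleNr.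
    by apply/eqP; rewrite -addr_eq0 E.
  split=> //; move: E; rewrite a0 scale0r add0r => /eqP.
  by rewrite scaler_eq0 (negPf v0) orbF => /eqP.
rewrite free_cons seq1_free span_seq1; apply/andP; split.
  apply/negP => /vlineP[k uk]; have [] := i 1 (- k).
    by rewrite scale1r scaleNr uk subrr.
  by move/eqP; rewrite oner_eq0.
apply/negP => /eqP v0; have [] := i 0 1; first by rewrite v0 scaler0 scale0r addr0.
by move=> _ /eqP; rewrite oner_eq0.
Qed.

Lemma indep_orth u v : u != 0 -> v != 0 -> dot v u = 0 -> indep u v.
Proof.
move=> u0 v0 vu a b E; have := congr1 (dot v) E; rewrite !dotE vu mulr0 add0r.
move/eqP; rewrite mulf_eq0 dot_eq0 (negPf v0) orbF => /eqP b0; split => //.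
by move/eqP: E; rewrite b0 scale0r addr0 scaler_eq0 (negPf u0) orbF => /eqP.
Qed.

Lemma dot_transversal v w : v != 0 -> w != 0 -> exists y, dot v y != 0 /\ dot w y != 0.
Proof.
move=> v0 w0; have [h|h] := eqVneq (dot w v) 0; last first.
  by exists v; split => //; exact: dot_neq0.
exists (v + w); rewrite !dotE h dotC h addr0 add0r.
by rewrite !dot_neq0.
Qed.

Definition planereg (D : 'rV[R]_n -> Prop) (G : 'rV[R]_n -> R) := forall o u v,
  free [:: u; v] -> (forall s t, D (o + s *: u + t *: v)) ->
  forall st, regat (@poly2 R) (fun st => G (o + st.1 *: u + st.2 *: v)) st.

End Dot.

Section Bounded.
Variable R : realType.

Lemma many_affine (A : R -> Prop) a b : b != 0 -> many A -> many (fun x => A (a + b * x)).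
Proof.
move=> b0 mA s; have [y] := mA [seq a + b * x | x <- s].
have E : y = a + b * (b^-1 * (y - a)) by rewrite mulrA mulfV // mul1r addrC subrK.
move=> ys Ay; exists (b^-1 * (y - a)); last by rewrite -E.
by apply: contra ys => h; apply/mapP; exists (b^-1 * (y - a)).
Qed.

(** Induction on [k]: on each slice there is a bound, infinitely many slices
    share one, and every line across the slices meets those slices. *)
Lemma uniform_bound k (P : 'rV[R]_k -> nat -> Prop) :
  (forall x, exists d, P x d) ->
  (forall x y d, many (fun m => P (x + m *: y) d) -> forall m, P (x + m *: y) d) ->
  exists d, forall x, P x d.
Proof.
elim: k P => [|k IH] P Pex Pline.
  by have [d Pd] := Pex 0; exists d => x; rewrite thinmx0.
have [|d md] := @many_pigeonhole R (fun c d => forall x : 'rV_k, P (row_mx c%:M x : 'rV_(1 + k)) d).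
  move=> c; apply: IH => [x|x y d m]; first exact: Pex.
  have E m' : row_mx c%:M (x + m' *: y) = row_mx c%:M x + m' *: row_mx 0 y :> 'rV_(1 + k).
    by rewrite scale_row_mx add_row_mx scaler0 addr0.
  by move=> m'; rewrite E; apply: Pline; apply: many_sub m => m''; rewrite E.
exists d => x; pose x' : 'rV_(1 + k) := x.
have E c : row_mx c%:M (rsubmx x') = row_mx 0 (rsubmx x') + c *: row_mx 1%:M 0 :> 'rV_(1 + k).
  by rewrite scale_row_mx add_row_mx scaler0 addr0 add0r scale_scalar_mx mulr1.
suff: P (row_mx (lsubmx x' 0 0)%:M (rsubmx x')) d by rewrite -mx11_scalar hsubmxK.
by rewrite E; apply: Pline; apply: many_sub md => c h; rewrite -E.
Qed.

Lemma regat1_degle (g : R -> R) t : regat (@poly1 R) g t -> exists d, degle d g.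
Proof.
move=> [phi [psi [[p Ep] [q Eq] q0 E]]]; exists (maxn (size p) (size q)), p, q; split.
- apply/orP; right; apply: contraNneq q0 => q0; rewrite Eq q0 horner0 //.
- by rewrite leqW // leq_maxl.
- by rewrite leqW // leq_maxr.
- by move=> x; rewrite -Ep -Eq.
Qed.

Variables (n : nat) (n3 : (3 <= n)%N).
Variable G : 'rV[R]_n -> R.
Hypothesis rG : planereg (fun x => x != 0) G.
Implicit Types o e x y u v w : 'rV[R]_n.

Lemma dot0_avoid v o e : dot v o != 0 -> dot v e = 0 -> forall t : R, o + t *: e != 0.
Proof.
by move=> vo ve t; apply: contraNneq vo => E; have := congr1 (dot v) E;
   rewrite !dotE ve mulr0 addr0 => ->.
Qed.

(** A line avoiding the origin lies on a plane avoiding the origin: add a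
    direction orthogonal to the plane through the line and the origin. *)
Lemma regular_line o w : (forall t : R, o + t *: w != 0) ->
  forall t, regat (@poly1 R) (fun t => G (o + t *: w)) t.
Proof.
move=> av t; have [->|w0] := eqVneq w 0.
  under eq_fun do rewrite scaler0; apply: regat_id; first exact: funalg_poly1.
  exact: funalg_cst (funalg_poly1 R) _.
have [v [v0 vo vw]] := orth2 o w n3.
have fr : free [:: w; v] by apply/indep_free/indep_orth.
have avp s t' : o + s *: w + t' *: v != 0.
  apply/negP => /eqP E; have := congr1 (dot v) E; rewrite !dotE vo vw mulr0 !add0r.
  move/eqP; rewrite mulf_eq0 dot_eq0 (negPf v0) orbF => /eqP t'0.
  by have := av s; rewrite -E t'0 scale0r addr0 eqxx.
have := rG fr avp (t, 0).
move=> /(@regat_comp R _ _ (@poly2 R) (@poly1 R) (fun t => (t, 0)) _ t) h.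
have -> : (fun t => G (o + t *: w)) =
    (fun st : R * R => G (o + st.1 *: w + st.2 *: v)) \o (fun t : R => (t, 0)).
  by apply/funext => t' /=; rewrite scale0r addr0.
apply: h => g; apply: poly2_comp; first exact: funalg_poly1.
  exact: poly1_id.
exact: funalg_cst (funalg_poly1 R) _.
Qed.

(** Move a line parallel to itself within a plane that avoids the origin. *)
Lemma degle_translate o e y d : (forall t m : R, o + t *: e + m *: y != 0) ->
  many (fun m => degle d (fun t => G (o + m *: y + t *: e))) ->
  forall m, degle d (fun t => G (o + m *: y + t *: e)).
Proof.
move=> av; apply: (@degle_family R d (fun m t => G (o + m *: y + t *: e))) => t m.
by under eq_fun do rewrite addrAC; exact: regular_line.
Qed.

(** Turn a line around one of its points within a plane that avoids the
    origin. *)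
Lemma degle_rotate o e y d : (forall s t : R, o + s *: e + t *: y != 0) ->
  many (fun m => degle d (fun t => G (o + t *: (e + m *: y)))) ->
  forall m, degle d (fun t => G (o + t *: (e + m *: y))).
Proof.
move=> av; apply: (@degle_family R d (fun m t => G (o + t *: (e + m *: y)))) => t m.
have E m' : o + t *: (e + m' *: y) = o + t *: e + m' *: (t *: y).
  by rewrite scalerDr addrA !scalerA mulrC.
under eq_fun do rewrite E; apply: regular_line => m'.
by rewrite scalerA.
Qed.

(** Slice by the hyperplanes [dot w = c] parallel to [e].  For [c != 0] they
    avoid the origin, so [uniform_bound] applies within each of them, and
    [many_pigeonhole] gives a bound valid on infinitely many slices; any line
    is then reached by translating across the slices. *)
Lemma bounded_direction e : exists d, forall o, (forall t : R, o + t *: e != 0) ->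
  degle d (fun t => G (o + t *: e)).
Proof.
have [w [w0 we _]] := orth2 e e n3.
have ww := dot_neq0 w0.
(* the orthogonal projection onto the hyperplane orthogonal to [w] *)
pose pr x := x - (dot w x / dot w w) *: w.
have wpr x : dot w (pr x) = 0 by rewrite !dotE mulfVK // subrr.
have prD x y m : pr (x + m *: y) = pr x + m *: pr y.
  rewrite /pr !dotE mulrDl -mulrA scalerDl scalerBr.
  by rewrite scalerA opprD addrACA.
have prK x : (dot w x / dot w w) *: w + pr x = x by rewrite addrC subrK.
clearbody pr.
have [|d md] := @many_pigeonhole R (fun c d => c != 0 -> forall x,
    degle d (fun t => G (c *: w + pr x + t *: e))).
  move=> c; have [->|c0] := eqVneq c 0; first by exists 0%N.
  have av x t y m : c *: w + pr x + t *: e + m *: pr y != 0.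
    apply/negP => /eqP/(congr1 (dot w))/eqP; rewrite !dotE !wpr we.
    by rewrite !mulr0 !addr0 mulf_eq0 (negPf c0) (negPf ww).
  have [|x y d|d dP] := @uniform_bound n (fun x d => degle d (fun t => G (c *: w + pr x + t *: e))).
  - move=> x; apply: (@regat1_degle _ 0); apply: regular_line => t.
    by have := av x t 0 0; rewrite scale0r addr0.
  - have E m : c *: w + pr (x + m *: y) = c *: w + pr x + m *: pr y.
      by rewrite -addrA -prD.
    move=> mP m; rewrite E; apply: degle_translate => [t m'|]; first exact: av.
    by apply: many_sub mP => m'; rewrite E.
  - by exists d.
have {}md := many_notin [:: 0] md.
exists d => o av.
have [v [v0 vo ve]] := orth2 o e n3.
have [y [vy wy]] := dot_transversal v0 w0.
have := @degle_translate o e y d _ _ 0; rewrite scale0r addr0; apply.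
  move=> t m; apply/negP => /eqP E; have := congr1 (dot v) E.
  rewrite !dotE vo ve mulr0 !add0r => /eqP; rewrite mulf_eq0 (negPf vy) orbF => /eqP m0.
  by have := av t; rewrite -E m0 scale0r addr0 eqxx.
have b0 : dot w y / dot w w != 0 by rewrite mulf_neq0 // invr_eq0.
apply: many_sub (many_affine (dot w o / dot w w) b0 md) => m [].
rewrite inE => c0 /(_ c0 (o + m *: y)); congr (degle d _).
apply/funext => t; congr (G (_ + _)).
rewrite -[RHS]prK; congr (_ *: _ + _).
by rewrite !dotE mulrDl [_ / _ * m]mulrC mulrA.
Qed.

(** [uniform_bound] applied to the direction.  When the plane in which the line
    should turn passes through the origin, it is first pushed off along its
    normal [v]. *)
Lemma bounded_degree : exists d, forall e o, (forall t : R, o + t *: e != 0) ->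
  degle d (fun t => G (o + t *: e)).
Proof.
apply: uniform_bound => [e|e y d md m o av]; first exact: bounded_direction.
have rot o' : (forall s t : R, o' + s *: e + t *: y != 0) ->
    degle d (fun t => G (o' + t *: (e + m *: y))).
  move=> av'; apply: degle_rotate => //; apply: many_sub md => m' h; apply: h => t.
  by rewrite scalerDr addrA scalerA.
have [v [v0 ve vy]] := orth2 e y n3.
have [vo|vo] := eqVneq (dot v o) 0; last first.
  apply: rot => s t; apply/negP => /eqP/(congr1 (dot v))/eqP.
  by rewrite !dotE ve vy !mulr0 !addr0 (negPf vo).
have := @degle_translate o (e + m *: y) v d _ _ 0; rewrite scale0r addr0; apply.
  move=> t m'; apply/negP => /eqP E; have := congr1 (dot v) E.
  rewrite !dotE vo ve vy !mulr0 !add0r !mulr0 !add0r => /eqP.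
  rewrite mulf_eq0 dot_eq0 (negPf v0) orbF => /eqP m0.
  by have := av t; rewrite -E m0 scale0r addr0 eqxx.
apply: many_sub (many_notin [:: 0] (@many_true R)) => m' []; rewrite inE => m0 _.
apply: rot => s t; apply/negP => /eqP/(congr1 (dot v))/eqP.
by rewrite !dotE ve vy vo !mulr0 !addr0 add0r mulf_eq0 (negPf m0) dot_eq0 (negPf v0).
Qed.

(** If the plane spanned by [a] and the line avoids the origin, this is
    [pencil_degle] in that plane.  The other positions are limits of such
    ones: translate the line if [a] and [e] are independent, and turn it
    first if they are not. *)
Lemma degle_spread a d : a != 0 ->
  (forall e, (forall t : R, a + t *: e != 0) -> degle d (fun t => G (a + t *: e))) ->
  forall e o, (forall t : R, o + t *: e != 0) -> degle d (fun t => G (o + t *: e)).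
Proof.
move=> a0 da.
have generic e o : indep e (o - a) ->
    (forall s t : R, a + s *: e + t *: (o - a) != 0) -> degle d (fun t => G (o + t *: e)).
  move=> /indep_free fr av; have rg := rG fr av.
  have := pencil_degle rg; move=> /(_ d) /=.
  have -> : (fun s => G (a + s *: e + 1 *: (o - a))) = (fun t => G (o + t *: e)).
    by apply/funext => s; rewrite scale1r addrAC [a + _]addrC subrK.
  apply=> m; have E t : a + t *: e + (m * t) *: (o - a) = a + t *: (e + m *: (o - a)).
    by rewrite [t *: (e + _)]scalerDr addrA scalerA [t * m]mulrC.
  by under eq_fun do rewrite E; apply: da => t; rewrite -E.
have transv e o : indep a e -> (forall t : R, o + t *: e != 0) -> degle d (fun t => G (o + t *: e)).
  move=> ae av; have e0 : e != 0.
    apply/negP => /eqP e0; have E : 0 *: a + 1 *: e = 0 by rewrite e0 scaler0 scale0r addr0.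
    by have [_ /eqP] := ae _ _ E; rewrite oner_eq0.
  have [v [v0 va ve]] := orth2 a e n3.
  have [w [w0 wo we]] := orth2 o e n3.
  (* Translating along [y], the form [dot v] keeps the plane of [a] and the line
     away from the origin, except for one position, and [dot w] does so for the
     line itself. *)
  have [y [vy wy]] := dot_transversal v0 w0.
  have := @degle_translate o e y d _ _ 0; rewrite scale0r addr0; apply.
    move=> t m; apply/negP => /eqP E; have := congr1 (dot w) E.
    rewrite !dotE wo we mulr0 !add0r => /eqP; rewrite mulf_eq0 (negPf wy) orbF => /eqP m0.
    by have := av t; rewrite -E m0 scale0r addr0 eqxx.
  have := many_affine (dot v o) vy (many_notin [:: 0] (@many_true R)).
  apply: many_sub => m []; rewrite inE => c0 _.
  have E : dot v (o + m *: y - a) = dot v o + dot v y * m.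
    by rewrite !dotE va subr0 mulrC.
  apply: generic => [al be|s t].
    move=> E0; have := congr1 (dot v) E0; rewrite [dot v (_ + _)]dotDr !dotZr E ve.
    rewrite mulr0 add0r dot0r => /eqP; rewrite mulf_eq0 (negPf c0) orbF => /eqP b0.
    split => //; move/eqP: E0; rewrite b0 scale0r addr0 scaler_eq0 (negPf e0) orbF.
    by move=> /eqP.
  apply/negP => /eqP E0; have := congr1 (dot v) E0.
  rewrite dotDr dotZr E dotDr va dotZr ve mulr0 !add0r dot0r => /eqP.
  rewrite mulf_eq0 (negPf c0) orbF => /eqP t0.
  have E1 : 1 *: a + s *: e = 0 by rewrite scale1r -E0 t0 scale0r addr0.
  by have [/eqP] := ae _ _ E1; rewrite oner_eq0.
move=> e o av; have [ae|nae] := pselect (indep a e); first exact: transv.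
have [->|e0] := eqVneq e 0.
  by under eq_fun do rewrite scaler0; exact: degle_cst.
have [k ak] : exists k, a = k *: e.
  apply: contrapT => nk; apply: nae => al be E.
  have al0 : al = 0.
    apply: contrapT => /eqP al0; apply: nk; exists (- (al^-1 * be)).
    apply: (scalerI al0); rewrite scalerA mulrN mulrA mulfV // mul1r scaleNr.
    by apply/eqP; rewrite -addr_eq0 E.
  split=> //; move/eqP: E; rewrite al0 scale0r add0r scaler_eq0 (negPf e0) orbF.
  by move=> /eqP.
have [v [v0 vo ve]] := orth2 o e n3.
have va : dot v a = 0 by rewrite ak !dotE ve mulr0.
have avv s t : o + s *: e + t *: v != 0.
  apply/negP => /eqP E; have := congr1 (dot v) E; rewrite !dotE vo ve mulr0 !add0r.
  move=> /eqP; rewrite mulf_eq0 dot_eq0 (negPf v0) orbF => /eqP t0.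
  by have := av s; rewrite -E t0 scale0r addr0 eqxx.
have := @degle_rotate o e v d avv _ 0; rewrite scale0r addr0; apply.
apply: many_sub (many_notin [:: 0] (@many_true R)) => m []; rewrite inE => m0 _.
apply: transv => [al be E|t]; last by rewrite scalerDr addrA scalerA.
have := congr1 (dot v) E; rewrite !dotE va ve mulr0 !add0r => /eqP.
rewrite !mulf_eq0 dot_eq0 (negPf v0) (negPf m0) !orbF => /eqP b0.
split => //; move/eqP: E; rewrite b0 scale0r addr0 scaler_eq0 (negPf a0) orbF.
by move=> /eqP.
Qed.
End Bounded.

(** * Regularity from transversal hyperplanes *)

Section Local.
Variable R : realType.

(** Right multiplication by this matrix inserts a zero coordinate at [i]. *)
Definition insert0 k (i : 'I_k.+1) : 'M[R]_(k, k.+1) := row' i 1%:M.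

Lemma insert0_at k (i : 'I_k.+1) (y : 'rV[R]_k) : (y *m insert0 i) ord0 i = 0.
Proof.
by rewrite mxE big1 // => l _; rewrite !mxE eq_sym (negPf (neq_lift _ _)) mulr0.
Qed.

Lemma insert0_lift k (i : 'I_k.+1) (y : 'rV[R]_k) l :
  (y *m insert0 i) ord0 (lift i l) = y ord0 l.
Proof.
rewrite mxE (bigD1 l) //= !mxE eqxx mulr1 big1 ?addr0 // => j jl.
by rewrite !mxE (inj_eq lift_inj) (negPf jl) mulr0.
Qed.

Lemma polyn_dotl k v : @polyn R k (dot v).
Proof.
apply: funalg_sum => [|i]; first exact: funalg_polyn.
apply: (funalg_mul (funalg_polyn R k)); last exact: polyn_coord.
exact: (funalg_cst (funalg_polyn R k)).
Qed.

(** Hyperplanes of constant nonzero [i]-th coordinate avoid the origin. *)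
Lemma planereg_section k (G : 'rV[R]_k.+1 -> R) i (b : 'rV[R]_k.+1) :
  planereg (fun x => x != 0) G -> b ord0 i != 0 ->
  planereg (fun=> True) (fun y => G (b + y *m insert0 i)).
Proof.
move=> rG bi o u v /indep_free fr _ st.
have E s t : b + (o + s *: u + t *: v) *m insert0 i =
    (b + o *m insert0 i) + s *: (u *m insert0 i) + t *: (v *m insert0 i).
  by rewrite !mulmxDl -!scalemxAl !addrA.
under eq_fun do rewrite E; apply: rG => [|s t].
  apply/indep_free => al be E0; apply: fr; apply/rowP => l.
  rewrite -(insert0_lift i) mulmxDl -!scalemxAl E0 !mxE //.
apply: contra bi => /eqP/(congr1 (fun x : 'rV_k.+1 => x ord0 i)).
by rewrite -E mxE insert0_at addr0 mxE => ->.
Qed.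

(** Choose [i] with [e_i != 0], and write a point as [a + T e + Y] with [Y] in
    the hyperplane of zero [i]-th coordinate.  The cofactors [c x] of the
    linear system for the line through [x] are regular functions of [Y], because
    the sample points [ts] are taken so that their hyperplanes avoid the origin.
    They define a fraction equal to [G] wherever the line through [x] avoids the
    origin, and in particular off the hypersurface [dot v x = 0]. *)
Lemma regular_transversal k (G : 'rV[R]_k.+1 -> R) (a e : 'rV[R]_k.+1) D :
  (3 <= k.+1)%N ->
  (forall H : 'rV[R]_k -> R, planereg (fun=> True) H -> forall y, regat (@polyn R k) H y) ->
  planereg (fun x => x != 0) G -> e != 0 -> (forall t : R, a + t *: e != 0) ->
  (forall o, (forall t : R, o + t *: e != 0) -> degle D (fun t => G (o + t *: e))) ->
  (forall d, degle d (fun t => G (a + t *: e)) -> (D <= d)%N) ->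
  regat (@polyn R k.+1) G a.
Proof.
move=> k3 IH rG e0 av deg Dmin.
have [i ei] : exists i, e ord0 i != 0.
  apply: contrapT => ne; case/negP: e0; apply/eqP/rowP => i; rewrite mxE.
  by apply: contrapT => /eqP h; apply: ne; exists i.
have mT : many (fun t => a ord0 i + t * e ord0 i != 0).
  have := many_affine (a ord0 i) ei (many_notin [:: 0] (@many_true R)).
  by apply: many_sub => t []; rewrite inE mulrC.
have [ts [i0 [tsT qt]]] := cramer_exact (regular_line k3 rG av) (deg a av) Dmin mT.
pose J := insert0 i.
pose T (x : 'rV[R]_k.+1) := (x ord0 i - a ord0 i) / e ord0 i.
pose Y (x : 'rV[R]_k.+1) : 'rV[R]_k := \row_l (x - a - T x *: e) ord0 (lift i l).
have coordE x : x = a + T x *: e + Y x *m J.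
  apply/rowP => j; rewrite [RHS]mxE; have [l|] := unliftP i j => ->.
    by rewrite insert0_lift !mxE; ring.
  by rewrite insert0_at !mxE addr0 /T mulfVK // addrC subrK.
have Ta : T a = 0 by rewrite /T subrr mul0r.
have Ya : Y a = 0 by apply/rowP => l; rewrite !mxE Ta mul0r subrr subr0.
have pT : polyn T.
  apply: (funalg_mul (funalg_polyn R _)); last exact: (funalg_cst (funalg_polyn R _)).
  apply: (funalg_add (funalg_polyn R _)); first exact: polyn_coord.
  exact: (funalg_cst (funalg_polyn R _)).
have pY l : polyn (fun x => Y x ord0 l).
  have -> : (fun x => Y x ord0 l) = (fun x => x ord0 (lift i l) +
      (- a ord0 (lift i l) + (- e ord0 (lift i l)) * T x)).
    by apply/funext => x; rewrite !mxE; ring.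
  apply: (funalg_add (funalg_polyn R _)); first exact: polyn_coord.
  apply: (funalg_add (funalg_polyn R _)); first exact: (funalg_cst (funalg_polyn R _)).
  apply: (funalg_mul (funalg_polyn R _)) => //; exact: (funalg_cst (funalg_polyn R _)).
pose c x := cofcol (sample (fun t => G (a + Y x *m J + t *: e)) ts : 'M_(D.+1 + D.+1)) i0.
have al := funalg_regat a (funalg_polyn R k.+1).
have reg_poly f : polyn f -> regat (@polyn R k.+1) f a.
  by move=> pf; apply: regat_id => //; exact: funalg_polyn.
have rc j : regat (@polyn R k.+1) (fun x => c x j 0) a.
  under eq_fun do rewrite mxE /cofactor.
  apply: (funalg_mul al); first exact: (funalg_cst al).
  apply: (@funalg_det _ _ _ _ (fun x => row' i0 (col' j
    (sample (fun t => G (a + Y x *m J + t *: e)) ts))) al) => r s.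
  have ne : lift i0 r != i0 by rewrite eq_sym neq_lift.
  have E x : row' i0 (col' j (sample (fun t => G (a + Y x *m J + t *: e)) ts)) r s =
      obs D (ts (lift i0 r)) (G (a + Y x *m J + ts (lift i0 r) *: e)) 0 (lift j s).
    by rewrite [LHS]mxE [LHS]mxE [LHS]mxE.
  under eq_fun do rewrite E.
  rewrite /obs; have [j'|j'] := split_ordP (lift j s) => ->.
    by under eq_fun do rewrite row_mxEl mxE; exact: (funalg_cst al).
  under eq_fun do rewrite row_mxEr mxE -mulrN.
  apply: (funalg_mul al); last exact: (funalg_cst al).
  set t := ts _; have bi : (a + t *: e) ord0 i != 0 by rewrite !mxE; exact: tsT.
  have := IH _ (planereg_section rG bi) (Y a).
  move=> /(@regat_comp R _ _ (@polyn R k) (@polyn R k.+1) Y _ a) h.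
  have -> : (fun x => G (a + Y x *m J + t *: e)) =
      (fun y => G (a + t *: e + y *m insert0 i)) \o Y.
    by apply/funext => x /=; rewrite addrAC.
  by apply: h => f; apply: polyn_comp => //; exact: funalg_polyn.
have rev (S : 'cV[R]_(D.+1 + D.+1) -> {poly R}) h :
    (forall x, S (c x) = rVpoly (\row_(l < D.+1) c x (h l) 0)) ->
    regat (@polyn R k.+1) (fun x => (S (c x)).[T x]) a.
  move=> SE; under eq_fun do rewrite SE horner_rV.
  apply: (funalg_sum _ al) => l; under eq_fun do rewrite mxE.
  apply: (funalg_mul al) => //; apply: (funalg_exp _ al); exact: reg_poly.
(* The part of [a] orthogonal to [e]: as [dot v] is constant along each line
   of direction [e], its nonvanishing certifies that the line avoids the
   origin. *)
pose v := a - (dot a e / dot e e) *: e.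
have vD x : dot x v = dot x a - dot a e / dot e e * dot x e by rewrite /v !dotE.
have v0 : v != 0 by have := av (- (dot a e / dot e e)); rewrite scaleNr.
clearbody v.
have ve : dot v e = 0 by rewrite dotC vD [dot e a]dotC mulfVK ?subrr // dot_neq0.
have va : dot v a != 0 by have := dot_neq0 v0; rewrite vD ve mulr0 subr0.
apply: (@regat_div R _ (@polyn R k.+1) G (fun x => (numer (c x)).[T x])
  (fun x => (denom (c x)).[T x]) (dot v)) => //.
- exact: funalg_polyn.
- apply: (rev (@numer R D) (lshift D.+1)) => x; rewrite /numer; congr rVpoly.
  by apply/rowP => l; rewrite !mxE.
- apply: (rev (@denom R D) (@rshift D.+1 D.+1)) => x; rewrite /denom; congr rVpoly.
  by apply/rowP => l; rewrite !mxE.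
- exact: polyn_dotl.
- rewrite /c Ya mul0mx addr0; exact: qt.
- move=> x vx; rewrite [in G x](coordE x) addrAC.
  apply: (@cramer_generic R D (fun t => G (a + Y x *m J + t *: e))); apply: deg.
  apply: (@dot0_avoid _ _ v) => //.
  by move: vx; rewrite {1}(coordE x) addrAC !dotE ve mulr0 addr0.
Qed.

(** A line through [a] that attains the least bound [D] for all lines through
    [a] satisfies the hypotheses of [regular_transversal]. *)
Lemma regular_punctured k (G : 'rV[R]_k.+1 -> R) : (3 <= k.+1)%N ->
  (forall H : 'rV[R]_k -> R, planereg (fun=> True) H -> forall y, regat (@polyn R k) H y) ->
  planereg (fun x => x != 0) G -> forall a, a != 0 -> regat (@polyn R k.+1) G a.
Proof.
move=> k3 IH rG a a0; have [d0 bd] := bounded_degree k3 rG.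
have [D [degD Dmin]] := @nat_least (fun d => forall e, (forall t : R, a + t *: e != 0) ->
  degle d (fun t => G (a + t *: e))) (ex_intro _ d0 (fun e => bd e a)).
have all_deg := degle_spread k3 rG a0 degD.
suff [e [e0 av emin]] : exists e, [/\ e != 0, forall t : R, a + t *: e != 0 &
    forall d, degle d (fun t => G (a + t *: e)) -> (D <= d)%N].
  by apply: (regular_transversal k3 IH rG e0 av _ emin) => o; exact: all_deg.
(* If [D] is zero any direction will do; otherwise [D.-1] is not a bound. *)
have [D0|D0] := posnP D.
  have [v [v0 va _]] := orth2 a a k3; exists v; split => //; last by rewrite D0.
  by apply: (@dot0_avoid _ _ a); rewrite ?dot_neq0 // dotC.
have : ~ forall e, (forall t : R, a + t *: e != 0) -> degle D.-1 (fun t => G (a + t *: e)).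
  by move=> /Dmin; rewrite leqNgt ltn_predL D0.
move=> /existsNP[e /not_implyP[av ndeg]]; exists e; split => //.
  apply: contra_notN ndeg => /eqP ->; under eq_fun do rewrite scaler0.
  exact: degle_cst.
move=> d dd; rewrite leqNgt; apply/negP => dD; apply: ndeg.
by apply: degle_leq dd; rewrite -ltnS prednK.
Qed.

(** In higher dimension the hypothesis is stronger than the one of
    [regular_punctured], for any choice of the origin; put it off [a]. *)
Lemma regular_of_planes k (G : 'rV[R]_k -> R) : (2 <= k)%N ->
  planereg (fun=> True) G -> forall a, regat (@polyn R k) G a.
Proof.
case: k G => [//|[//|k]] G _; elim: k G => [|k IH] G rG a.
  pose u : 'rV[R]_2 := delta_mx 0 0; pose v : 'rV[R]_2 := delta_mx 0 1.
  have fr : free [:: u; v].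
    apply/indep_free => al be E.
    have := congr1 (fun x : 'rV_2 => (x 0 0, x 0 1)) E; rewrite !mxE /=.
    by rewrite !mulr1 !mulr0 addr0 add0r => -[-> ->].
  have := rG 0 u v fr (fun _ _ => I) (a 0 0, a 0 1).
  move=> /(@regat_comp R _ _ (@poly2 R) (@polyn R 2) (fun x => (x 0 0, x 0 1)) _ a) h.
  have -> : G = (fun st : R * R => G (0 + st.1 *: u + st.2 *: v)) \o
     (fun x : 'rV_2 => (x 0 0, x 0 1)).
    apply/funext => x /=; congr G; apply/rowP => j; rewrite !mxE /=.
    by case: j => [[|[|//]]] jp; rewrite /= ?mulr1 ?mulr0 ?addr0 add0r ?add0r;
      congr (x _ _); exact: val_inj.
  apply: h => f; apply: poly2_comp; first exact: funalg_polyn.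
    exact: polyn_coord.
  exact: polyn_coord.
pose c : 'rV[R]_k.+3 := a - delta_mx 0 0.
have ac : a - c != 0.
  rewrite /c opprB addrC subrK; apply/negP => /eqP/rowP/(_ 0); rewrite !mxE /=.
  by move/eqP; rewrite oner_eq0.
have rG' : planereg (fun x => x != 0) (fun x => G (x + c)).
  move=> o u v fr _ st.
  have E s t : o + s *: u + t *: v + c = (o + c) + s *: u + t *: v.
    by rewrite addrAC [o + _ + c]addrAC.
  by under eq_fun do rewrite E; exact: rG.
have := regular_punctured (isT : (3 <= k.+3)%N) IH rG' ac.
move=> /(@regat_comp R _ _ (@polyn R k.+3) (@polyn R k.+3) (fun x => x - c) _ a) h.
have -> : G = (fun x => G (x + c)) \o (fun x => x - c).
  by apply/funext => x /=; rewrite subrK.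
apply: h => f; apply: polyn_comp => [|i]; first exact: funalg_polyn.
under eq_fun do rewrite !mxE.
apply: (funalg_add (funalg_polyn R _)); first exact: polyn_coord.
exact: (funalg_cst (funalg_polyn R _)).
Qed.

Lemma regular_off_origin n (G : 'rV[R]_n -> R) : (3 <= n)%N ->
  planereg (fun x => x != 0) G -> forall a, a != 0 -> regat (@polyn R n) G a.
Proof.
case: n G => // k G k3; apply: regular_punctured => // H.
exact: regular_of_planes.
Qed.
End Local.

(** * Inversion and spheres *)

Section Inversion.
Variables (R : realType) (n : nat).
Implicit Types (x y u v b c o : 'rV[R]_n) (f h : 'rV[R]_n -> R).

Definition inversion b y : 'rV[R]_n := b + (dot y y)^-1 *: y.

Lemma polyn_dot_self : @polyn R n (fun y => dot y y).
Proof.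
apply: funalg_sum => [|i]; first exact: funalg_polyn.
by apply: (funalg_mul (funalg_polyn R n)); exact: polyn_coord.
Qed.

(** The functions that become polynomial after multiplication by a power of
    [|y|^2] form an algebra, which contains the coordinates of the inversion. *)
Lemma polyn_inversion b h : polyn h -> exists K g, polyn g /\
  forall y, y != 0 -> dot y y ^+ K * h (inversion b y) = g y.
Proof.
have al := funalg_polyn R n.
pose A (k : 'rV[R]_n -> R) := exists K g, polyn g /\
  forall y, y != 0 -> dot y y ^+ K * k y = g y.
have pN K : polyn (fun y => dot y y ^+ K) by apply: funalg_exp => //; exact: polyn_dot_self.
apply: (polyn_comp (A := A)) => [|i].
  split.
  - move=> c; exists 0%N, (fun=> c); split; first exact: (funalg_cst al).
    by move=> y _; rewrite mul1r.
  - move=> k k' [K [g [pg E]]] [K' [g' [pg' E']]].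
    exists (K + K')%N, (fun y => dot y y ^+ K' * g y + dot y y ^+ K * g' y); split.
      by apply: (funalg_add al); apply: (funalg_mul al).
    by move=> y y0; rewrite -E // -E' // exprD; ring.
  - move=> k k' [K [g [pg E]]] [K' [g' [pg' E']]].
    exists (K + K')%N, (fun y => g y * g' y); split; first exact: (funalg_mul al).
    by move=> y y0; rewrite -E // -E' // exprD; ring.
exists 1%N, (fun y => b ord0 i * dot y y + y ord0 i); split.
  apply: (funalg_add al); last exact: polyn_coord.
  by apply: (funalg_mul al); [exact: (funalg_cst al)|exact: polyn_dot_self].
by move=> y /dot_neq0 y0; rewrite !mxE expr1 mulrDr mulVKf // mulrC.
Qed.

Lemma inversion_pullback b f phi psi y0 : polyn phi -> polyn psi ->
  y0 != 0 -> psi (inversion b y0) != 0 -> exists Phi Psi,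
  [/\ polyn Phi, polyn Psi, Psi y0 != 0 & forall y, y != 0 ->
    (psi (inversion b y) != 0 ->
       f (inversion b y) = phi (inversion b y) / psi (inversion b y)) ->
    Psi y * f (inversion b y) = Phi y].
Proof.
move=> /(polyn_inversion b)[K [g [pg E]]] /(polyn_inversion b)[K' [g' [pg' E']]] y00 psi0.
have al := funalg_polyn R n.
have pN k : polyn (fun y => dot y y ^+ k) by apply: funalg_exp => //; exact: polyn_dot_self.
exists (fun y => dot y y ^+ K' * (g' y * g y)), (fun y => dot y y ^+ K * (g' y * g' y)).
split.
- by do 2![apply: (funalg_mul al) => //].
- by do 2![apply: (funalg_mul al) => //].
- by rewrite -E' // !mulf_neq0 // expf_neq0 // dot_neq0.
- move=> y yn0 Ef; rewrite -E // -E' //.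
  have [->|p0] := eqVneq (psi (inversion b y)) 0; first by rewrite !(mulr0, mul0r).
  by rewrite Ef //; field.
Qed.

(** Gram-Schmidt on [u] and [v]. *)
Lemma foot_of_perpendicular o u v : free [:: u; v] ->
  exists s t, dot (o + s *: u + t *: v) u = 0 /\ dot (o + s *: u + t *: v) v = 0.
Proof.
move=> /indep_free fr.
have u0 : u != 0.
  apply/negP => /eqP u0; have E : 1 *: u + 0 *: v = 0 by rewrite u0 scaler0 scale0r addr0.
  by have [/eqP] := fr _ _ E; rewrite oner_eq0.
pose k := dot v u / dot u u.
have w0 : v - k *: u != 0.
  apply/negP => /eqP w0; have E : (- k) *: u + 1 *: v = 0.
    by rewrite scale1r scaleNr addrC.
  by have [_ /eqP] := fr _ _ E; rewrite oner_eq0.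
have shear s t l : o + s *: u + t *: v = o + (s + t * l) *: u + t *: (v - l *: u).
  by apply/rowP => i; rewrite !mxE; ring.
have uu := dot_neq0 u0; have ww := dot_neq0 w0.
pose t := - (dot o (v - k *: u) / dot (v - k *: u) (v - k *: u)).
pose s := - (dot o u / dot u u) - t * k.
have E1 : dot (o + s *: u + t *: v) u = 0.
  by rewrite !dotE /s /k; field.
exists s, t; split => //.
have wu : dot u (v - k *: u) = 0 by rewrite !dotE [dot u v]dotC /k mulfVK ?subrr.
have E2 : dot (o + s *: u + t *: v) (v - k *: u) = 0.
  rewrite (shear s t k); by rewrite !dotDl !dotZl wu mulr0 addr0 /t mulNr mulfVK // subrr.
by move: E2; rewrite dotDr dotNr dotZr E1 mulr0 subr0.
Qed.

(** If [c] is the foot of the perpendicular from the origin to the plane, then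
    [dot y c = dot c c] for all [y] of the plane, which says precisely that
    [y / |y|^2] is at distance [1 / (2 |c|)] from [c / (2 |c|^2)]. *)
Lemma plane_inversion_sphere b o u v : free [:: u; v] ->
  (forall s t : R, o + s *: u + t *: v != 0) ->
  exists2 S, euclidean_2sphere S & forall s t, S (inversion b (o + s *: u + t *: v)).
Proof.
move=> fr av; have [s0 [t0 []]] := foot_of_perpendicular o fr.
set c := o + s0 *: u + t0 *: v => cu cv.
have c0 : c != 0 by exact: av.
have yE s t : o + s *: u + t *: v = c + (s - s0) *: u + (t - t0) *: v.
  by apply/rowP => i; rewrite !mxE; ring.
have cc := dot_neq0 c0.
pose W := <<[:: o; u; v]>>%VS.
have oW : o \in W by rewrite memv_span // !inE eqxx.
have uW : u \in W by rewrite memv_span // !inE eqxx orbT.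
have vW : v \in W by rewrite memv_span // !inE eqxx !orbT.
have yW s t : o + s *: u + t *: v \in W by rewrite !memvD ?memvZ.
have dW : \dim W = 3.
  apply/eqP; rewrite -[3%N]/(size [:: o; u; v]) -/(free _) free_cons fr andbT.
  rewrite span_cons span_seq1; apply/negP => /memv_addP[_ /vlineP[k ->]] [_ /vlineP[l ->]] E.
  by have := av (- k) (- l); rewrite {1}E !scaleNr addrAC addrK subrr eqxx.
have cW : c \in W by exact: yW.
clearbody c.
exists ([set x | enorm (x - (b + (2 * dot c c)^-1 *: c)) = Num.sqrt (4 * dot c c)^-1]
    `&` [set x | x - b \in W]).
  exists [set x | x - b \in W], (b + (2 * dot c c)^-1 *: c), (Num.sqrt (4 * dot c c)^-1).
  split => //.
  - by exists b, W.
  - by rewrite /= addrC addKr memvZ.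
  - rewrite sqrtr_gt0 invr_gt0 mulr_gt0 // lt_neqAle eq_sym cc /=.
    by apply: sumr_ge0 => i _; rewrite -expr2 sqr_ge0.
move=> s t; split; last by rewrite /= /inversion addrC addKr memvZ // yW.
set y := o + s *: u + t *: v.
have y0 := dot_neq0 (av s t : y != 0).
have yc : dot y c = dot c c.
  by rewrite /y yE !dotDl !dotZl [dot u c]dotC [dot v c]dotC cu cv !mulr0 !addr0.
clearbody y; rewrite /= /enorm /inversion; congr Num.sqrt.
transitivity (dot ((dot y y)^-1 *: y - (2 * dot c c)^-1 *: c)
                  ((dot y y)^-1 *: y - (2 * dot c c)^-1 *: c)).
  by apply: eq_bigr => i _; rewrite -expr2 !mxE; congr (_ ^+ 2); ring.
rewrite -!scaleNr !(dotDl, dotDr, dotZl, dotZr) [dot c y]dotC yc.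
by field; rewrite cc y0.
Qed.

Lemma inversionK y : y != 0 -> inversion 0 (inversion 0 y) = y.
Proof.
move=> /dot_neq0 y0; rewrite /inversion !add0r !dotZl !dotZr scalerA.
by rewrite (_ : _ * _ = 1) ?scale1r //; field.
Qed.

(** The center [b] of inversion only has to differ from [a]. *)
Lemma regular_of_spheres f : (3 <= n)%N ->
  (forall S, euclidean_2sphere S -> regular_on S f) ->
  forall a, regat (@polyn R n) f a.
Proof.
move=> n3 rS a; have al := funalg_polyn R n.
have [w [w0 _ _]] := orth2 a a n3.
pose b := a - w; pose F y := f (inversion b y).
have w'0 : inversion 0 w != 0.
  by rewrite /inversion add0r scaler_eq0 negb_or w0 invr_eq0 dot_neq0.
have rF : planereg (fun x => x != 0) F.
  move=> o u v fr av st; have [S eS SP] := plane_inversion_sphere b fr av.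
  have [phi [psi [psi0 E]]] := rS S eS _ (SP st.1 st.2).
  have [||Phi [Psi [pPhi pPsi Psi0 EE]]] := @inversion_pullback b f
    (fun x => mpoly.meval (x ord0) phi) (fun x => mpoly.meval (x ord0) psi)
    (o + st.1 *: u + st.2 *: v) _ _ (av _ _) psi0.
  - by exists phi.
  - by exists psi.
  have aff g : polyn g -> poly2 (fun st => g (o + st.1 *: u + st.2 *: v)).
    apply: polyn_comp => [|i]; first exact: funalg_poly2.
    have al2 := funalg_poly2 R; under eq_fun do rewrite !mxE.
    apply: (funalg_add al2); first (apply: (funalg_add al2)).
    - exact: (funalg_cst al2).
    - by apply: (funalg_mul al2); [exact: poly2_fst|exact: (funalg_cst al2)].
    - by apply: (funalg_mul al2); [exact: poly2_snd|exact: (funalg_cst al2)].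
  exists (fun st => Phi (o + st.1 *: u + st.2 *: v)),
    (fun st => Psi (o + st.1 *: u + st.2 *: v)); split; [exact: aff|exact: aff|done|].
  by move=> st'; apply: EE => [|h]; [exact: av|apply: E => //; exact: SP].
have [phi [psi [pphi ppsi psi0 E]]] := regular_off_origin n3 rF w'0.
have [Phi [Psi [pPhi pPsi Psi0 EE]]] :=
  @inversion_pullback 0 F phi psi w pphi ppsi w0 psi0.
have tr g : polyn g -> polyn (fun x => g (x - b)).
  apply: polyn_comp => // i; under eq_fun do rewrite !mxE.
  by apply: (funalg_add al); [exact: polyn_coord|exact: (funalg_cst al)].
exists (fun x => dot (x - b) (x - b) * Phi (x - b)),
  (fun x => dot (x - b) (x - b) * Psi (x - b)); split.
- by apply: (tr (fun y => dot y y * Phi y)); apply: (funalg_mul al) => //; exact: polyn_dot_self.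
- by apply: (tr (fun y => dot y y * Psi y)); apply: (funalg_mul al) => //; exact: polyn_dot_self.
- by rewrite /b opprB addrC subrK mulf_neq0 // dot_neq0.
move=> x; have [->|xb] := eqVneq (x - b) 0; first by rewrite dot0r !mul0r.
rewrite -mulrA -EE //; last by move=> h; rewrite -E mulrC mulKf.
congr (_ * (_ * _)); rewrite /F; congr f.
have := inversionK xb; rewrite {1}/inversion add0r => h.
by rewrite {1}/inversion h addrC subrK.
Qed.

End Inversion.

Theorem theorem1p6 (R : realType) (n : nat) (hn : (3 <= n)%N)
    (f : 'rV[R]_n -> R) :
  regular_on [set: 'rV[R]_n] f <->
  (forall S : set 'rV[R]_n, euclidean_2sphere S -> regular_on S f).
Proof.
split=> [rf S _ a _ | rS a _].
  have [phi [psi [psi0 E]]] := rf a I.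
  by exists phi, psi; split => // x _; exact: E.
have [Phi [Psi [[phi Ephi] [psi Epsi] psi0 E]]] := regular_of_spheres hn rS a.
exists phi, psi; rewrite -Epsi; split => // x _; rewrite -Epsi -Ephi -E => px.
by rewrite mulrC mulKf.
Qed.
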